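(* Let $R$ be a right and left Ore ring, let $S$ be the set of all regular elements of $R$, and let $Q=R[S^{-1}]=[S^{-1}]R$ be the classical right and left ring of quotients of $R$. Assume that $\mathrm{F.dim}(Q_Q)=0$. Then the following conditions are equivalent: (i) Flat right $R$-modules are strongly flat. (ii) Matlis-cotorsion right $R$-modules are Enochs-cotorsion. (iii) $h$-divisible right $R$-modules are weak-injective. (iv) Homomorphic images of weak-injective right $R$-modules are weak-injective. (v) Homomorphic images of injective right $R$-modules are weak-injective. (vi) Right $R$-modules of weak dimension $\le 1$ are of projective dimension $\le 1$. (vii) The cotorsion pairs $(\mathcal{P}_1,\mathcal{D})$ and $(\mathcal{F}_1,\mathcal{WI})$ coincide. (viii) Divisible right $R$-modules are weak-injective.
   Context: Rings are associative with identity and modules are unital. An element of $R$ is regular if it is neither a left nor a right zero-divisor. $R$ is a right and left Ore ring if for all $x,y\in R$ with $x$ regular there exist $u,v,u',v'\in R$ with $v,v'$ regular, $ux=vy$ and $xu'=yv'$; equivalently, both classical rings of quotients $R[S^{-1}]$ and $[S^{-1}]R$ exist, and then they coincide. $R$ is viewed as a subring of $Q$. $\mathrm{F.dim}(Q_Q)=0$ means that every right $Q$-module has projective dimension $0$ or $\infty$. For a class $\mathcal{A}$ of right $R$-modules, ${}^{\perp}\mathcal{A}=\{B : \mathrm{Ext}^1_R(B,A)=0 \text{ for all } A\in\mathcal{A}\}$ and $\mathcal{A}^{\perp}=\{B : \mathrm{Ext}^1_R(A,B)=0\text{ for all }A\in\mathcal{A}\}$. A cotorsion pair is a pair $(\mathcal{A},\mathcal{B})$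 of classes of right $R$-modules with $\mathcal{A}={}^{\perp}\mathcal{B}$ and $\mathcal{B}=\mathcal{A}^{\perp}$. A right $R$-module $M$ is: Matlis-cotorsion if $\mathrm{Ext}^1_R(Q_R,M)=0$; strongly flat if $\mathrm{Ext}^1_R(M,C)=0$ for every Matlis-cotorsion right $R$-module $C$; Enochs-cotorsion if $\mathrm{Ext}^1_R(F,M)=0$ for every flat right $R$-module $F$; $h$-divisible if it is a homomorphic image (as a right $R$-module) of a direct sum of copies of $Q_R$; divisible if $Ms=M$ for every $s\in S$; weak-injective if $\mathrm{Ext}^1_R(I,M)=0$ for every right $R$-module $I$ of weak dimension $\le 1$. Weak dimension means flat dimension. $\mathcal{P}_1$, $\mathcal{F}_1$, $\mathcal{D}$, $\mathcal{WI}$ denote the classes of right $R$-modules that are, respectively, of projective dimension $\le1$, of weak dimension $\le 1$, divisible, weak-injective. Condition (vii) means that $\mathcal{P}_1=\mathcal{F}_1$ and $\mathcal{D}=\mathcal{WI}$. *)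

(* Defs.v *)
From HB Require Import structures.
From mathcomp Require Import all_boot all_order all_algebra.

Set Implicit Arguments.
Unset Strict Implicit.
Unset Printing Implicit Defensive.

Import GRing.Theory.
Local Open Scope ring_scope.

(* MathComp's [lmodType R] is the type of left R-modules; a right R-module is a
   left module over the converse ring R^c, with [m r] written [r *: m].        *)
Notation rmodType R := (lmodType R^c).

Definition surj (A B : Type) (f : A -> B) : Prop := forall y, exists x, f x = y.

Definition exact_at (R : pzRingType) (A B C : lmodType R)
    (f : {linear A -> B}) (g : {linear B -> C}) : Prop :=
  forall y, g y = 0 <-> exists x, f x = y.

Definition homomorphic_image (R : pzRingType) (M N : lmodType R) : Prop :=
  exists f : {linear M -> N}, surj f.

(** Ext^1 is Yoneda's: the set of equivalence classes of extensions of A by B,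
    whose zero element is the class of the split extension. *)

Record extension (R : pzRingType) (A B : lmodType R) := Extension {
  ext_mid : lmodType R;
  ext_inj : {linear B -> ext_mid};
  ext_proj : {linear ext_mid -> A};
  ext_injP : injective ext_inj;
  ext_exactP : exact_at ext_inj ext_proj;
  ext_projP : surj ext_proj
}.

(* By the five lemma such an h is automatically bijective. *)
Definition ext_equiv (R : pzRingType) (A B : lmodType R)
    (E E' : extension A B) : Prop :=
  exists h : {linear ext_mid E -> ext_mid E'},
    (forall b, h (ext_inj E b) = ext_inj E' b) /\
    (forall e, ext_proj E' (h e) = ext_proj E e).

Section SplitExtension.
Variables (R : pzRingType) (A B : lmodType R).

Definition split_inj (b : B) : (B * A)%type := (b, 0).
Definition split_proj (u : (B * A)%type) : A := u.2.

Fact split_inj_linear : linear split_inj.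
Proof. by move=> r x y; rewrite /split_inj; congr pair; rewrite /= ?scaler0 ?addr0. Qed.

Fact split_proj_linear : linear split_proj.
Proof. by []. Qed.

HB.instance Definition _ :=
  GRing.isLinear.Build R B (B * A)%type _ split_inj split_inj_linear.
HB.instance Definition _ :=
  GRing.isLinear.Build R (B * A)%type A _ split_proj split_proj_linear.

Fact split_injP : injective split_inj.
Proof. by move=> x y []. Qed.

Fact split_exactP : exact_at split_inj split_proj.
Proof.
move=> [b a]; split; first by rewrite /split_proj /= => ->; exists b.
by case=> x <-.
Qed.

Fact split_projP : surj split_proj.
Proof. by move=> a; exists (0, a). Qed.

Definition split_extension : extension A B :=
  Extension split_injP split_exactP split_projP.

End SplitExtension.

Definition Ext1_zero (R : pzRingType) (A B : lmodType R) : Prop :=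
  forall E : extension A B, ext_equiv E (split_extension A B).

Definition projective_mod (R : pzRingType) (P : lmodType R) : Prop :=
  forall (M N : lmodType R) (p : {linear M -> N}) (f : {linear P -> N}),
    surj p -> exists g : {linear P -> M}, forall x, p (g x) = f x.

Definition injective_mod (R : pzRingType) (E : lmodType R) : Prop :=
  forall (M N : lmodType R) (i : {linear M -> N}) (f : {linear M -> E}),
    injective i -> exists g : {linear N -> E}, forall x, g (i x) = f x.

Section Tensor.
Variables (R : pzRingType) (M : rmodType R) (N : lmodType R).

Definition balanced (T : zmodType) (t : M -> N -> T) : Prop :=
  [/\ forall m m' n, t (m + m') n = t m n + t m' n,
      forall m n n', t m (n + n') = t m n + t m n' &
      forall m (r : R) n, t ((r : R^c) *: m) n = t m (r *: n)].

Definition is_tensor (T : zmodType) (t : M -> N -> T) : Prop :=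
  balanced t /\
  forall (A : zmodType) (b : M -> N -> A), balanced b ->
    exists g : {additive T -> A},
      (forall m n, g (t m n) = b m n) /\
      (forall g' : {additive T -> A},
         (forall m n, g' (t m n) = b m n) -> g' =1 g).

End Tensor.

(* Injectivity of M (x) N -> M (x) N' does not depend on the chosen models
   (T, t), (T', t') of the two tensor products; g is the map M (x) f.         *)
Definition flat_mod (R : pzRingType) (M : rmodType R) : Prop :=
  forall (N N' : lmodType R) (f : {linear N -> N'}), injective f ->
  forall (T T' : zmodType) (t : M -> N -> T) (t' : M -> N' -> T'),
    is_tensor t -> is_tensor t' ->
  forall g : {additive T -> T'},
    (forall m n, g (t m n) = t' m (f n)) -> injective g.

Record resolution (R : pzRingType) (C : lmodType R -> Prop) (M : lmodType R) :=
  Resolution {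
    res_term : nat -> lmodType R;
    res_diff : forall n, {linear res_term n.+1 -> res_term n};
    res_aug : {linear res_term 0 -> M};
    res_termP : forall n, C (res_term n);
    res_augP : surj res_aug;
    res_exact0 : exact_at (res_diff 0) res_aug;
    res_exactS : forall n, exact_at (res_diff n.+1) (res_diff n)
  }.

Definition resolution_dim_le (R : pzRingType) (C : lmodType R -> Prop)
    (n : nat) (M : lmodType R) : Prop :=
  exists X : resolution C M,
    forall k, (n < k)%N -> forall x : res_term X k, x = 0.

Definition proj_dim_le (R : pzRingType) : nat -> lmodType R -> Prop :=
  resolution_dim_le (@projective_mod R).

Definition weak_dim_le (R : pzRingType) : nat -> rmodType R -> Prop :=
  resolution_dim_le (@flat_mod R).

(* F.dim(Q_Q) = 0 *)
Definition right_Fdim_zero (Q : pzRingType) : Prop :=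
  forall M : rmodType Q, proj_dim_le 0 M \/ forall n, ~ proj_dim_le n M.

Definition is_direct_sum (R : pzRingType) (I : Type) (A : I -> lmodType R)
    (D : lmodType R) (inj : forall i, {linear A i -> D}) : Prop :=
  forall (N : lmodType R) (f : forall i, {linear A i -> N}),
    exists g : {linear D -> N},
      (forall i x, g (inj i x) = f i x) /\
      (forall g' : {linear D -> N},
         (forall i x, g' (inj i x) = f i x) -> g' =1 g).

Definition regular (R : pzRingType) (x : R) : Prop := GRing.lreg x /\ GRing.rreg x.

Definition right_left_Ore (R : pzRingType) : Prop :=
  forall x y : R, regular x ->
    exists u v u' v' : R,
      [/\ regular v, regular v', u * x = v * y & x * u' = y * v'].

Definition is_inverse (R : pzRingType) (x y : R) : Prop := x * y = 1 /\ y * x = 1.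

(* Q = R[S^-1] = [S^-1]R via the embedding iota, S the regular elements of R *)
Record is_classical_quotient_ring (R Q : pzRingType) (iota : {rmorphism R -> Q}) :
    Prop := IsClassicalQuotientRing {
  cq_inj : injective iota;
  cq_inv : forall s : R, regular s -> exists t, is_inverse (iota s) t;
  cq_right : forall q : Q, exists (r s : R) (t : Q),
    [/\ regular s, is_inverse (iota s) t & q = iota r * t];
  cq_left : forall q : Q, exists (r s : R) (t : Q),
    [/\ regular s, is_inverse (iota s) t & q = t * iota r]
}.

(** The right R-module Q_R, with q r := q * iota r. *)
Definition restr_right (R Q : pzRingType) (iota : {rmorphism R -> Q}) : Type := Q.

Section RestrRight.
Variables (R Q : pzRingType) (iota : {rmorphism R -> Q}).
Local Notation QR := (restr_right iota).

HB.instance Definition _ := GRing.Zmodule.copy QR Q.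

Definition restr_right_scale (r : R^c) (q : QR) : QR := (q : Q) * iota r.

Fact restr_right_scaleA a b (q : QR) :
  restr_right_scale a (restr_right_scale b q) = restr_right_scale (a * b) q.
Proof. by rewrite /restr_right_scale -mulrA -rmorphM. Qed.

Fact restr_right_scale1 : left_id 1 restr_right_scale.
Proof. by move=> q; rewrite /restr_right_scale rmorph1 mulr1. Qed.

Fact restr_right_scaleDr : right_distributive restr_right_scale +%R.
Proof. by move=> a q q'; apply: mulrDl. Qed.

Fact restr_right_scaleDl (q : QR) : {morph restr_right_scale^~ q : a b / a + b}.
Proof. by move=> a b; rewrite /restr_right_scale rmorphD mulrDr. Qed.

HB.instance Definition _ := GRing.Zmodule_isLmodule.Build R^c QR
  restr_right_scaleA restr_right_scale1 restr_right_scaleDr restr_right_scaleDl.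

End RestrRight.

Section Classes.
Variables (R Q : pzRingType) (iota : {rmorphism R -> Q}).
Local Notation Q_R := (restr_right iota : rmodType R).

Definition Matlis_cotorsion (M : rmodType R) : Prop := Ext1_zero Q_R M.

Definition strongly_flat (M : rmodType R) : Prop :=
  forall C : rmodType R, Matlis_cotorsion C -> Ext1_zero M C.

Definition Enochs_cotorsion (M : rmodType R) : Prop :=
  forall F : rmodType R, flat_mod F -> Ext1_zero F M.

Definition h_divisible (M : rmodType R) : Prop :=
  exists (I : Type) (D : rmodType R) (inj : I -> {linear Q_R -> D}),
    is_direct_sum inj /\ homomorphic_image D M.

Definition divisible (M : rmodType R) : Prop :=
  forall s : R, regular s -> forall m : M, exists m' : M, (s : R^c) *: m' = m.

Definition weak_injective (M : rmodType R) : Prop :=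
  forall I : rmodType R, weak_dim_le 1 I -> Ext1_zero I M.

End Classes.

(* Main.v *)
From HB Require Import structures.
From mathcomp Require Import all_boot all_order all_algebra.
From mathcomp Require Import boolp classical_sets functions.
Require Import Defs.

(** Regular elements act bijectively on a [Q]-module, and [F |-> F (x)_R Q] ([loc]) is
    exact, preserves projectivity and does not change [Q]-modules.  Because
    [F.dim Q = 0], the cokernel of an injection of projective [Q]-modules, having
    projective dimension at most one, is projective, so that the injection splits
    ([split_of_Fdim_zero]).  Whenever [K -> P] is injective with projective
    localisations, this turns maps defined on [K (x) Q] into maps defined on [P]; the
    implications (ii) => (iii), (vi) => (vii) and (vi) => (i) rest on it.

    (ii) => (iii).  Every [Q]-module is Matlis-cotorsion, and [F (x) Q] is flat over [R]
    when [F] is; so (ii) makes [F (x) Q] projective over [Q] ([projective_loc_flat]).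
    An [h]-divisible [M] is [V / N] with [V] free over [Q] and [N] Matlis-cotorsion
    ([h_divisible_presentation]).  If [K -> F] is an injection of flat modules, a map
    [K -> M] lifts to [V] because [Ext(K, N) = 0], extends to [K (x) Q] because [V] is a
    [Q]-module, and reaches [F] through the splitting ([h_divisible_extend]).

    (iii) => (iv) and (v) => (vi).  Since [Q / R] has weak dimension at most one,
    weak-injective modules are [h]-divisible, and images of [h]-divisible modules are
    [h]-divisible.  Embedding modules into injective ones, (v) kills
    [Ext^2(M, -)] for every [M] of weak dimension at most one
    ([proj_dim_le1_of_quotients]).

    (vi) => (vii).  The point is that [F.dim Q = 0] forces [Ext(B, M) = 0] for [B] of
    projective dimension at most one and [M] divisible ([divisible_Ext1_zero]).  Let
    [0 -> K -> P -> B -> 0] be exact, with [P] free on [X] and [K]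
    projective, with dual basis [y, eta_y].  Splitting [K (x) Q -> P (x) Q] yields
    coefficients [theta y x] in [Q], finitely many nonzero for each [x], with
    [eta_y k = sum_x theta y x * k_x] for [k] in [K] with coordinates [k_x].  For a
    countable family of elements of [Q] there is a chain of cyclic submodules [t_n R]
    containing it, along which divisibility extends any map [R -> M]
    ([divisible_extend]).  Hence, were [X] countable, [f : K -> M] would be extended by
    [x |-> sum_y phi_y (theta y x)], where [phi_y] extends [r |-> f y r].  In general
    [X] is exhausted by subsets [C], closed under the finitely many interactions that
    [theta] creates, for which the elements of [K] supported in [C] form a direct
    summand of [K]; each is obtained from smaller ones by adding a countable set
    ([partial_extension_step]), and Zorn's lemma concludes.

    (vi) => (i).  A flat [M] embeds into [V = M (x) Q]; [V] is projective over [Q] and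
    [V / M] has projective dimension at most one, so the vanishing of [Ext(V, C)] for
    Matlis-cotorsion [C] passes to [M] ([flat_strongly_flat]).

    Flatness enters through the equational criterion ([flat_eq_flat],
    [eq_flat_flat]), which is stable under clearing denominators. *)

Set Implicit Arguments.
Unset Strict Implicit.
Unset Printing Implicit Defensive.

Import Order.TTheory GRing.Theory Num.Theory.
Local Open Scope classical_set_scope.
Local Open Scope ring_scope.

(** * Submodules, quotients and factorisations *)

Definition to_linear (A : pzRingType) (V W : lmodType A) (f : V -> W)
    (fL : linear f) : {linear V -> W} :=
  HB.pack f (GRing.isLinear.Build A V W *:%R f fL).

Record submodule (A : pzRingType) (V : lmodType A) := Submodule {
  sm_car :> V -> Prop;
  sm_0 : sm_car 0;
  sm_lin : forall a u v, sm_car u -> sm_car v -> sm_car (a *: u + v)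
}.

Section SubmoduleTheory.
Variables (A : pzRingType) (V : lmodType A) (U : submodule V).

Lemma sm_D u v : U u -> U v -> U (u + v).
Proof. by move=> Uu Uv; rewrite -[u]scale1r; apply: sm_lin. Qed.

Lemma sm_Z a u : U u -> U (a *: u).
Proof. by move=> Uu; rewrite -[_ *: _]addr0; apply: sm_lin => //; apply: sm_0. Qed.

Lemma sm_N u : U u -> U (- u).
Proof. by rewrite -scaleN1r; apply: sm_Z. Qed.

Definition sm_pred : {pred V} := fun v => `[< U v >].

Fact sm_pred_closed : submod_closed sm_pred.
Proof.
split; first by apply/asboolP/sm_0.
by move=> a u v /asboolP Uu /asboolP Uv; apply/asboolP/sm_lin.
Qed.

HB.instance Definition _ := GRing.isSubmodClosed.Build A V sm_pred sm_pred_closed.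

Definition subm : Type := {v : V | v \in sm_pred}.
HB.instance Definition _ := SubChoice.on subm.
HB.instance Definition _ := [SubChoice_isSubLmodule of subm by <:].

(** Sealing the inclusion keeps simplification from exposing the subtype. *)
Fact subm_incl_sig : {i : {linear subm -> V} |
  injective i /\ forall v, U v <-> exists x, i x = v}.
Proof.
exists (\val : {linear subm -> V}); split; first exact: val_inj.
move=> v; split=> [Uv|[x <-]]; last exact/asboolP/(valP x).
by exists (exist _ v (introT (asboolP _) Uv)).
Qed.

Definition subm_incl : {linear subm -> V} := sval subm_incl_sig.

Lemma subm_inj : injective subm_incl.
Proof. exact: (svalP subm_incl_sig).1. Qed.

Lemma subm_exists v : U v -> exists x, subm_incl x = v.
Proof. by move/(svalP subm_incl_sig).2. Qed.

Lemma submP (x : subm) : U (subm_incl x).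
Proof. by apply/(svalP subm_incl_sig).2; exists x. Qed.

(** Each class has a chosen representative, so that the quotient is a subtype of
    [V] and inherits its choice structure. *)
Definition qrep (v : V) : V := choose (fun u => `[< U (u - v) >]) v.

Lemma qrepP v : U (qrep v - v).
Proof.
apply/asboolP; apply: (chooseP (P := fun u => `[< U (u - v) >])).
by apply/asboolP; rewrite subrr; apply: sm_0.
Qed.

Lemma qrep_eq u v : U (u - v) -> qrep u = qrep v.
Proof.
move=> Uuv; rewrite /qrep (@eq_choose _ _ (fun w => `[< U (w - v) >])).
  by apply: choose_id; apply/asboolP => //; rewrite subrr; apply: sm_0.
move=> w; apply: asbool_equiv_eq; split=> [Uw|Uw].
  by rewrite -[w](subrK u) -addrA; apply: sm_D.
by rewrite -[w](subrK v) -addrA; apply: sm_D => //; rewrite -opprB; apply: sm_N.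
Qed.

Definition quot : Type := {v : V | qrep v == v}.
HB.instance Definition _ := SubChoice.on quot.

Fact qrep_idem v : qrep (qrep v) == qrep v.
Proof. by apply/eqP/qrep_eq/qrepP. Qed.

Definition qpi (v : V) : quot := exist _ (qrep v) (qrep_idem v).

Lemma qpi_eq u v : qpi u = qpi v <-> U (u - v).
Proof.
split=> [[euv]|Uuv]; last by apply: val_inj; apply: qrep_eq.
rewrite -[u](subrK (qrep u)) -addrA; apply: sm_D.
  by rewrite -opprB; apply/sm_N/qrepP.
by rewrite euv; apply: qrepP.
Qed.

Lemma qval (x : quot) : qpi (val x) = x.
Proof. by apply: val_inj; apply/eqP/(valP x). Qed.

Definition qadd (x y : quot) := qpi (val x + val y).
Definition qopp (x : quot) := qpi (- val x).
Definition qscale (a : A) (x : quot) := qpi (a *: val x).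

Lemma qaddE u v : qadd (qpi u) (qpi v) = qpi (u + v).
Proof. by apply/qpi_eq; rewrite opprD addrACA; apply: sm_D; apply: qrepP. Qed.
Lemma qoppE u : qopp (qpi u) = qpi (- u).
Proof. by apply/qpi_eq; rewrite -opprD; apply/sm_N/qrepP. Qed.
Lemma qscaleE a u : qscale a (qpi u) = qpi (a *: u).
Proof. by apply/qpi_eq; rewrite -scalerBr; apply/sm_Z/qrepP. Qed.

Fact qaddA : associative qadd.
Proof. by move=> x y z; rewrite -[x]qval -[y]qval -[z]qval !qaddE addrA. Qed.
Fact qaddC : commutative qadd.
Proof. by move=> x y; rewrite -[x]qval -[y]qval !qaddE addrC. Qed.
Fact qadd0 : left_id (qpi 0) qadd.
Proof. by move=> x; rewrite -[x]qval !qaddE add0r. Qed.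
Fact qaddN : left_inverse (qpi 0) qopp qadd.
Proof. by move=> x; rewrite -[x]qval qoppE !qaddE addNr. Qed.
HB.instance Definition _ := GRing.isZmodule.Build quot qaddA qaddC qadd0 qaddN.

Fact qscaleA a b x : qscale a (qscale b x) = qscale (a * b) x.
Proof. by rewrite -[x]qval !qscaleE scalerA. Qed.
Fact qscale1 : left_id 1 qscale.
Proof. by move=> x; rewrite -[x]qval !qscaleE scale1r. Qed.
Fact qscaleDr : right_distributive qscale +%R.
Proof.
move=> a x y; change (qscale a (qadd x y) = qadd (qscale a x) (qscale a y)).
by rewrite -[x]qval -[y]qval qaddE !qscaleE qaddE scalerDr.
Qed.
Fact qscaleDl x : {morph qscale^~ x : a b / a + b}.
Proof.
move=> a b; change (qscale (a + b) x = qadd (qscale a x) (qscale b x)).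
by rewrite -[x]qval !qscaleE qaddE scalerDl.
Qed.
HB.instance Definition _ := GRing.Zmodule_isLmodule.Build A quot
  qscaleA qscale1 qscaleDr qscaleDl.

Fact qpi_linear : linear qpi.
Proof. by move=> a u v; rewrite -qaddE -qscaleE. Qed.

Fact quot_proj_sig : {p : {linear V -> quot} |
  surj p /\ forall v, p v = 0 <-> U v}.
Proof.
exists (to_linear qpi_linear); split=> [x|v]; first by exists (val x); apply: qval.
by rewrite -[v in U v]subr0; apply: qpi_eq.
Qed.

Definition quot_proj : {linear V -> quot} := sval quot_proj_sig.

Lemma quot_projP : surj quot_proj.
Proof. exact: (svalP quot_proj_sig).1. Qed.

Lemma quot_proj0 v : quot_proj v = 0 <-> U v.
Proof. exact: (svalP quot_proj_sig).2. Qed.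

End SubmoduleTheory.

Section Factor.
Variable (A : pzRingType).

Lemma inj_of_ker (V W : lmodType A) (f : {linear V -> W}) :
  (forall x, f x = 0 -> x = 0) -> injective f.
Proof.
by move=> f0 x y fxy; apply/subr0_eq/f0; rewrite linearB /= fxy subrr.
Qed.

Lemma factor_surj (V W Z : lmodType A) (p : {linear V -> W}) (f : {linear V -> Z}) :
  surj p -> (forall x, p x = 0 -> f x = 0) ->
  exists g : {linear W -> Z}, forall x, g (p x) = f x.
Proof.
move=> /choice[s ps] pf; pose g w := f (s w).
have gE x : g (p x) = f x.
  by apply/subr0_eq; rewrite -linearB; apply: pf; rewrite linearB /= ps subrr.
have gL : linear g.
  by move=> a u v; rewrite -{1}[u]ps -{1}[v]ps -linearP gE linearP.
by exists (to_linear gL).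
Qed.

Lemma factor_inj (V W Z : lmodType A) (i : {linear W -> V}) (f : {linear Z -> V}) :
  injective i -> (forall z, exists w, i w = f z) ->
  exists g : {linear Z -> W}, forall z, i (g z) = f z.
Proof.
move=> iI /choice[g gE].
have gL : linear g by move=> a u v; apply: iI; rewrite linearP !gE linearP.
by exists (to_linear gL).
Qed.

Definition kernel_sm (V W : lmodType A) (f : {linear V -> W}) : submodule V.
Proof.
exists (fun v => f v = 0); first exact: linear0.
by move=> a u v fu fv; rewrite linearP fu fv scaler0 addr0.
Defined.

Definition range_sm (V W : lmodType A) (f : {linear V -> W}) : submodule W.
Proof.
exists (fun w => exists v, f v = w); first by exists 0; rewrite linear0.
by move=> a _ _ [u <-] [v <-]; exists (a *: u + v); rewrite linearP.
Defined.

Lemma kernel_exact (V W : lmodType A) (f : {linear V -> W}) :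
  exact_at (subm_incl (kernel_sm f)) f.
Proof.
move=> v; split=> [fv|[x <-]]; last exact: (submP x).
by apply: (@subm_exists _ _ (kernel_sm f)).
Qed.

Lemma quot_exact (V W : lmodType A) (f : {linear V -> W}) :
  exact_at f (quot_proj (range_sm f)).
Proof. by move=> w; split=> [/quot_proj0|fw]; [|apply/quot_proj0]. Qed.

End Factor.

(** * Extensions, lifting and extending homomorphisms *)

Section Ext.
Variable (A : pzRingType).

Definition pair_inl (M N : lmodType A) (x : M) : M * N := (x, 0).
Definition pair_inr (M N : lmodType A) (x : N) : M * N := (0, x).

Fact pair_inl_linear M N : linear (@pair_inl M N).
Proof. by move=> a u v; congr pair; rewrite /= scaler0 addr0. Qed.
Fact pair_inr_linear M N : linear (@pair_inr M N).
Proof. by move=> a u v; congr pair; rewrite /= scaler0 addr0. Qed.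
HB.instance Definition _ (M N : lmodType A) := GRing.isLinear.Build A M (M * N)%type _
  (@pair_inl M N) (@pair_inl_linear M N).
HB.instance Definition _ (M N : lmodType A) := GRing.isLinear.Build A N (M * N)%type _
  (@pair_inr M N) (@pair_inr_linear M N).

Lemma Ext1_zeroP (M B : lmodType A) :
  (forall E : extension M B, exists g : {linear M -> ext_mid E},
     forall x, ext_proj E (g x) = x) ->
  Ext1_zero M B.
Proof.
move=> spl E; have [g gE] := spl E.
pose d : {linear ext_mid E -> ext_mid E} :=
  (idfun \- (g \o ext_proj E) : {linear _ -> _}).
have [e|r rE] := factor_inj (@ext_injP _ _ _ E) (f := d).
  by apply/(@ext_exactP _ _ _ E); rewrite linearB /= gE subrr.
have hL : linear (fun e => (r e, ext_proj E e)).
  by move=> a u v; rewrite !linearP.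
exists (to_linear hL); split=> // b; congr pair; last first.
  by apply/(@ext_exactP _ _ _ E); exists b.
apply: (@ext_injP _ _ _ E); rewrite rE /=.
have -> : ext_proj E (ext_inj E b) = 0 by apply/(@ext_exactP _ _ _ E); exists b.
by rewrite linear0 subr0.
Qed.

Lemma Ext1_section (M B : lmodType A) : Ext1_zero M B ->
  forall E : extension M B, exists g : {linear M -> ext_mid E},
    forall x, ext_proj E (g x) = x.
Proof.
move=> ext0 E; have [h [hi hp]] := ext0 E.
have hI : injective h.
  apply: inj_of_ker => e he; have := hp e; rewrite he /= => /esym pe0.
  have /(@ext_exactP _ _ _ E) [b eb] : ext_proj E e = 0 by exact: pe0.
  by move: he; rewrite -eb hi => -[->]; rewrite linear0.
have [x|g gE] := factor_inj hI (f := @pair_inr B M).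
  have [e pe] := @ext_projP _ _ _ E x.
  exists (e - ext_inj E (h e).1); rewrite linearB hi /=.
  have := hp e; case: (h e) => u v /= uv.
  by rewrite /split_proj /= in uv; rewrite uv pe; congr pair; rewrite /= ?subrr ?subr0.
by exists g => x; rewrite -hp gE.
Qed.

(** The pullback along [f] is an extension of [M] by [C]; a section of it is a
    lift of [f]. *)
Lemma Ext1_lift (M C E N : lmodType A) (c : {linear C -> E})
    (p : {linear E -> N}) (f : {linear M -> N}) :
  Ext1_zero M C -> injective c -> exact_at c p -> surj p ->
  exists g : {linear M -> E}, forall x, p (g x) = f x.
Proof.
move=> ext0 cI cp pS.
pose W := kernel_sm ((f \o fst) \- (p \o snd) : {linear (M * E)%type -> N}).
have [b|j jE] := factor_inj (@subm_inj _ _ W) (f := (@pair_inr M E \o c : {linear _ -> _})).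
  apply: subm_exists; rewrite /= linear0 sub0r.
  by apply/eqP; rewrite oppr_eq0; apply/eqP/cp; exists b.
pose q1 : {linear subm W -> M} := (fst \o subm_incl W : {linear _ -> _}).
pose q2 : {linear subm W -> E} := (snd \o subm_incl W : {linear _ -> _}).
have jI : injective j.
  by move=> u v /(congr1 (subm_incl W)); rewrite !jE => -[/cI].
have jex : exact_at j q1.
  move=> w; split=> [w0|[b <-]]; last by rewrite /= jE.
  have /= := submP w; move: w0; rewrite /=.
  case ew: (subm_incl W w) => [x e] /= x0; rewrite x0 => /eqP.
  rewrite linear0 sub0r oppr_eq0 => /eqP /cp [b eb].
  by exists b; apply: (@subm_inj _ _ W); rewrite jE ew x0 /= eb.
have q1S : surj q1.
  move=> x; have [e pe] := pS (f x).
  have [|w wE] := @subm_exists _ _ W (x, e); first by rewrite /= pe subrr.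
  by exists w; rewrite /= wE.
have [g gE] := Ext1_section ext0 (Extension jI jex q1S).
exists (q2 \o g : {linear _ -> _}) => x /=.
have /= /eqP := submP (g x); rewrite subr_eq0 => /eqP <-.
by congr (f _); exact: gE.
Qed.

(** The pushout along [f] is an extension of [M] by [B]; subtracting a section of
    it from [P] leaves a map into [B]. *)
Lemma Ext1_extend (M B K P : lmodType A) (i : {linear K -> P})
    (p : {linear P -> M}) (f : {linear K -> B}) :
  Ext1_zero M B -> injective i -> exact_at i p -> surj p ->
  exists g : {linear P -> B}, forall x, g (i x) = f x.
Proof.
move=> ext0 iI ip pS.
pose W := range_sm ((@pair_inl B P \o f) \- (@pair_inr B P \o i) : {linear K -> (B * P)%type}).
pose q := quot_proj W.
pose j : {linear B -> quot W} := (q \o @pair_inl B P : {linear _ -> _}).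
pose p2 : {linear (B * P)%type -> M} := (p \o snd : {linear _ -> _}).
have [u|r rE] := factor_surj (f := p2) (@quot_projP _ _ W).
  by move=> /quot_proj0 [k <-] /=; apply/ip; exists (- k); rewrite linearN sub0r.
have jI : injective j.
  apply: inj_of_ker => b /quot_proj0 [k [/= <- /eqP]].
  by rewrite sub0r oppr_eq0 subr0 -(linear0 i) => /eqP/iI ->; rewrite linear0.
have jr : exact_at j r.
  move=> x; have [[b y] <-] := @quot_projP _ _ W x; rewrite rE /=.
  split=> [/ip[k <-]|[b' /esym/eqP]].
    exists (b + f k); apply/eqP; rewrite -subr_eq0 -linearB; apply/eqP/quot_proj0.
    by exists k; congr pair; rewrite /= ?sub0r ?subr0 // addrC addKr.
  rewrite -subr_eq0 -linearB => /eqP/quot_proj0 [k [_]] /= /eqP.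
  by rewrite sub0r subr0 => /eqP <-; apply/ip; exists (- k); rewrite linearN.
have rS : surj r.
  by move=> x; have [y <-] := pS x; exists (q (0, y)); rewrite rE.
have [g gE] := Ext1_section ext0 (Extension jI jr rS).
pose d : {linear P -> quot W} :=
  ((q \o @pair_inr B P) \- (g \o p) : {linear _ -> _}).
have [x|h hE] := factor_inj jI (f := d).
  apply/jr; rewrite linearB /= rE /=; have /= -> := gE (p x); exact: subrr.
exists h => k; apply: (jI); rewrite hE /=.
have -> : p (i k) = 0 by apply/ip; exists k.
rewrite linear0 subr0; apply/eqP; rewrite -subr_eq0 -linearB; apply/eqP/quot_proj0.
by exists (- k); rewrite /= !linearN opprK addrC.
Qed.

(** The long exact sequence at [Ext(M, B)]. *)
Lemma Ext1_zero_of_extend (M B K P : lmodType A) (i : {linear K -> P})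
    (p : {linear P -> M}) :
  Ext1_zero P B -> exact_at i p -> surj p ->
  (forall f : {linear K -> B}, exists g : {linear P -> B},
     forall x, g (i x) = f x) ->
  Ext1_zero M B.
Proof.
move=> P0 ip pS ex; apply: Ext1_zeroP => E.
have [u uE] := Ext1_lift p P0 (@ext_injP _ _ _ E) (@ext_exactP _ _ _ E) (@ext_projP _ _ _ E).
have [k|f fE] := factor_inj (@ext_injP _ _ _ E) (f := (u \o i : {linear _ -> _})).
  by apply/(@ext_exactP _ _ _ E); rewrite /= uE; apply/ip; exists k.
have [g gE] := ex f.
pose d : {linear P -> ext_mid E} := (u \- (ext_inj E \o g) : {linear _ -> _}).
have [x /ip[k <-]|s sE] := factor_surj (f := d) pS; first by rewrite /= gE fE subrr.
exists s => x; have [y <-] := pS x; rewrite sE linearB /= uE.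
have -> : ext_proj E (ext_inj E (g y)) = 0 by apply/(@ext_exactP _ _ _ E); exists (g y).
by rewrite subr0.
Qed.

Lemma projective_Ext1_zero (P B : lmodType A) : projective_mod P -> Ext1_zero P B.
Proof.
move=> Pp; apply: Ext1_zeroP => E.
exact: (Pp _ _ (ext_proj E) idfun (@ext_projP _ _ _ E)).
Qed.

Lemma Ext1_zero_of_retraction (M B : lmodType A) :
  (forall E : extension M B, exists r : {linear ext_mid E -> B},
     forall b, r (ext_inj E b) = b) ->
  Ext1_zero M B.
Proof.
move=> ret; apply: Ext1_zeroP => E; have [r rE] := ret E.
pose d : {linear ext_mid E -> ext_mid E} :=
  (idfun \- (ext_inj E \o r) : {linear _ -> _}).
have [x /(@ext_exactP _ _ _ E)[b <-]|s sE] := factor_surj (f := d) (@ext_projP _ _ _ E).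
  by rewrite /= rE subrr.
exists s => x; have [y <-] := @ext_projP _ _ _ E x; rewrite sE linearB /=.
have -> : ext_proj E (ext_inj E (r y)) = 0 by apply/(@ext_exactP _ _ _ E); exists (r y).
by rewrite subr0.
Qed.

Lemma injective_Ext1_zero (M I : lmodType A) : injective_mod I -> Ext1_zero M I.
Proof.
move=> Ii; apply: Ext1_zero_of_retraction => E.
exact: (Ii _ _ (ext_inj E) idfun (@ext_injP _ _ _ E)).
Qed.

(** * Projective modules and resolutions of length one *)

Definition retract_of (M N : lmodType A) :=
  exists (u : {linear M -> N}) (w : {linear N -> M}), forall x, w (u x) = x.

Lemma projective_retract (M N : lmodType A) :
  retract_of M N -> projective_mod N -> projective_mod M.
Proof.
move=> [u [w wu]] Np X Y p f pS.
have [g gE] := Np _ _ p (f \o w : {linear _ -> _}) pS.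
by exists (g \o u : {linear _ -> _}) => x; rewrite /= gE /= wu.
Qed.

Lemma projective_prod (M N : lmodType A) :
  projective_mod M -> projective_mod N -> projective_mod (M * N)%type.
Proof.
move=> Mp Np X Y p f pS.
have [g gE] := Mp _ _ p (f \o @pair_inl M N : {linear _ -> _}) pS.
have [h hE] := Np _ _ p (f \o @pair_inr M N : {linear _ -> _}) pS.
exists ((g \o fst) \+ (h \o snd) : {linear (M * N)%type -> X}) => -[x y].
rewrite /= linearD gE hE /= -linearD.
by congr (f _); congr pair; rewrite /= ?addr0 ?add0r.
Qed.

Definition zero_sm (V : lmodType A) : submodule V.
Proof.
by exists (fun v => v = 0) => // a u v -> ->; rewrite scaler0 addr0.
Defined.

Definition zero_mod : lmodType A := subm (zero_sm A^o).

Lemma zero_modE (x : zero_mod) : x = 0.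
Proof. by apply: (@subm_inj _ _ (zero_sm A^o)); rewrite linear0; exact: (submP x). Qed.

Definition zero_map (M N : lmodType A) : {linear M -> N} := (\0 : {linear M -> N}).

Lemma projective_zero_mod : projective_mod zero_mod.
Proof.
by move=> X Y p f pS; exists (zero_map _ _) => x; rewrite (zero_modE x) !linear0.
Qed.

Section Resolutions.
Variable C : lmodType A -> Prop.

Lemma resolution_dim_le1 (M : lmodType A) : resolution_dim_le C 1 M ->
  exists (K P : lmodType A) (i : {linear K -> P}) (p : {linear P -> M}),
    [/\ C K, C P, injective i, exact_at i p & surj p].
Proof.
move=> [X X0]; exists (res_term X 1), (res_term X 0), (res_diff X 0), (res_aug X).
split; [exact: res_termP | exact: res_termP | | exact: res_exact0 | exact: res_augP].
apply: inj_of_ker => x /(@res_exactS _ _ _ X 0) [y <-].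
by rewrite (X0 2 isT y) linear0.
Qed.

Lemma resolution_dim_le0 (M : lmodType A) : resolution_dim_le C 0 M ->
  exists (P : lmodType A) (p : {linear P -> M}), [/\ C P, injective p & surj p].
Proof.
move=> [X X0]; exists (res_term X 0), (res_aug X).
split; [exact: res_termP | | exact: res_augP].
apply: inj_of_ker => x /(@res_exact0 _ _ _ X) [y <-].
by rewrite (X0 1 isT y) linear0.
Qed.

Hypothesis C0 : C zero_mod.

Section Build.
Variables (M K P : lmodType A) (i : {linear K -> P}) (p : {linear P -> M}).
Hypotheses (CK : C K) (CP : C P) (iI : injective i) (ip : exact_at i p) (pS : surj p).

Definition short_term (n : nat) : lmodType A :=
  match n with 0 => P | 1 => K | _ => zero_mod end.

Definition short_diff (n : nat) : {linear short_term n.+1 -> short_term n} :=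
  match n with 0 => i | _ => zero_map _ _ end.

Lemma short_resolution : resolution_dim_le C 1 M.
Proof.
have Ct n : C (short_term n) by case: n => [|[|n]].
have exS n : exact_at (short_diff n.+1) (short_diff n).
  case: n => [|n] y; split=> [|[x <-]]; rewrite ?(zero_modE x) ?linear0 //.
    by move=> y0; exists 0; rewrite linear0; apply: iI; rewrite linear0.
  by move=> _; exists 0; rewrite linear0; case: n y => [|n] y; rewrite (zero_modE y).
exists (Resolution Ct pS ip exS) => k; case: k => [|[|k]] // _ x.
exact: zero_modE.
Qed.

End Build.
End Resolutions.

(** Schanuel's lemma: with [K1 -> P1] a projective presentation witnessing the
    dimension of [M], comparison maps [P -> P1 -> P] over [M] exhibit [K] as a
    retract of [K1 * P]. *)
Lemma projective_kernel (M K P : lmodType A) (i : {linear K -> P})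
    (p : {linear P -> M}) :
  proj_dim_le 1 M -> projective_mod P -> injective i -> exact_at i p -> surj p ->
  projective_mod K.
Proof.
move=> /resolution_dim_le1 [K1 [P1 [i1 [p1 [K1p P1p i1I ip1 p1S]]]]] Pp iI ip pS.
have [u uE] := Pp _ _ p1 p p1S.
have [w wE] := P1p _ _ p p1 pS.
have pi k : p (i k) = 0 by apply/ip; exists k.
have [k|u' u'E] := factor_inj i1I (f := (u \o i : {linear _ -> _})).
  by apply/ip1; rewrite /= uE.
have [k|w' w'E] := factor_inj iI (f := (w \o i1 : {linear _ -> _})).
  by apply/ip; rewrite /= wE; apply/ip1; exists k.
have [x|d dE] := factor_inj iI (f := (idfun \- (w \o u) : {linear _ -> _})).
  by apply/ip; rewrite /= linearB wE uE subrr.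
apply: (@projective_retract _ (K1 * P)%type); last exact: projective_prod.
exists ((@pair_inl K1 P \o u') \+ (@pair_inr K1 P \o i) : {linear K -> (K1 * P)%type}).
exists ((w' \o fst) \+ (d \o snd) : {linear (K1 * P)%type -> K}) => k; apply: iI.
by rewrite /= addr0 add0r linearD w'E dE /= u'E /= addrC subrK.
Qed.

End Ext.

(** * Finite sums, direct sums and free modules *)

Section FiniteSums.
Variable X : eqType.

Definition supported (V : nmodType) (s : seq X) (f : X -> V) :=
  forall x, x \notin s -> f x = 0.

Definition fin_supp (V : nmodType) (f : X -> V) := exists s, supported s f.

(** Meaningful for finitely supported [f] only; totality spares the proofs that
    would otherwise be carried by every sum. *)
Definition fsum (V : nmodType) (f : X -> V) : V :=
  if pselect (fin_supp f) is left s then \sum_(x <- undup (sval (cid s))) f x else 0.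

Lemma sum_supported (V : nmodType) (f : X -> V) s t :
  uniq s -> uniq t -> supported s f -> supported t f ->
  \sum_(x <- s) f x = \sum_(x <- t) f x.
Proof.
move=> us ut fs ft.
have cut (s1 t1 : seq X) : supported t1 f ->
    \sum_(x <- s1) f x = \sum_(x <- [seq x <- s1 | x \in t1]) f x.
  move=> ft1; rewrite big_filter [RHS]big_mkcond /=; apply: eq_bigr => x _.
  by case: ifPn => // /ft1.
rewrite (cut s t) // (cut t s) //; apply: perm_big.
apply: uniq_perm; rewrite ?filter_uniq // => x.
by rewrite !mem_filter andbC.
Qed.

Lemma fsumE (V : nmodType) (f : X -> V) s :
  uniq s -> supported s f -> fsum f = \sum_(x <- s) f x.
Proof.
move=> us fs; rewrite /fsum; case: pselect => [e|[]]; last by exists s.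
apply: sum_supported; rewrite ?undup_uniq // => x; rewrite mem_undup.
exact: (svalP (cid e)).
Qed.

Lemma fin_suppP (V : nmodType) (f : X -> V) : fin_supp f ->
  exists2 s, uniq s & supported s f.
Proof.
by move=> [s fs]; exists (undup s); rewrite ?undup_uniq // => x; rewrite mem_undup; apply: fs.
Qed.

Lemma fin_suppW (V W : nmodType) (f : X -> V) (g : X -> W) :
  (forall x, f x = 0 -> g x = 0) -> fin_supp f -> fin_supp g.
Proof. by move=> fg [s fs]; exists s => x /fs /fg. Qed.

Lemma fin_suppD (V : nmodType) (f g : X -> V) :
  fin_supp f -> fin_supp g -> fin_supp (fun x => f x + g x).
Proof.
move=> [s fs] [t gt]; exists (s ++ t) => x.
by rewrite mem_cat negb_or => /andP[/fs -> /gt ->]; rewrite addr0.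
Qed.

Lemma fsumD (V : nmodType) (f g : X -> V) : fin_supp f -> fin_supp g ->
  fsum (fun x => f x + g x) = fsum f + fsum g.
Proof.
move=> [s fs] [t gt]; pose r := undup (s ++ t).
have mr x : x \notin r -> (x \notin s) && (x \notin t).
  by rewrite mem_undup mem_cat negb_or.
have ur : uniq r by apply: undup_uniq.
rewrite !(@fsumE _ _ r) ?big_split //.
- by move=> x /mr /andP[_ /gt].
- by move=> x /mr /andP[/fs].
- by move=> x /mr /andP[/fs -> /gt ->]; rewrite addr0.
Qed.

Lemma fsum_morph (V W : nmodType) (phi : V -> W) (f : X -> V) :
  phi 0 = 0 -> {morph phi : u v / u + v} -> fin_supp f ->
  phi (fsum f) = fsum (fun x => phi (f x)).
Proof.
move=> phi0 phiD /fin_suppP[s us fs]; rewrite !(@fsumE _ _ s) //; last first.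
  by move=> x /fs ->.
exact: (big_morph phi phiD phi0).
Qed.

Lemma fsum_single (V : nmodType) (f : X -> V) x :
  (forall y, y != x -> f y = 0) -> fsum f = f x.
Proof.
move=> fx; rewrite (@fsumE _ _ [:: x]) ?big_seq1 // => y.
by rewrite inE => /fx.
Qed.

Lemma eq_fsum (V : nmodType) (f g : X -> V) : f =1 g -> fsum f = fsum g.
Proof. by move=> /funext ->. Qed.

End FiniteSums.

Lemma common_support (X : choiceType) (V : nmodType) (J : finType) (f : J -> X -> V) :
  (forall j, fin_supp (f j)) -> exists s, uniq s /\ forall j, supported s (f j).
Proof.
move=> /choice[s sE]; exists (undup (flatten [seq s j | j <- enum J])).
split=> [|j x]; first exact: undup_uniq.
rewrite mem_undup => xs; apply: sE; apply: contra xs => xs.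
by apply/flattenP; exists (s j) => //; apply: map_f; rewrite mem_enum.
Qed.

Section DirectSums.
Variables (A : pzRingType) (X : choiceType).

Section Def.
Variable V : lmodType A.

Definition fin_supp_sm : submodule (X -> V).
Proof.
exists (@fin_supp X V); first by exists [::].
move=> a f g Ff Fg; apply: (@fin_suppD _ _ (fun x => a *: f x) g) => //.
by apply: fin_suppW Ff => x ->; rewrite scaler0.
Defined.

Definition dsum : lmodType A := subm fin_supp_sm.

Definition coordinates (u : dsum) : X -> V := subm_incl fin_supp_sm u.

Lemma coordinatesP u : fin_supp (coordinates u).
Proof. exact: (submP u). Qed.

Lemma coordinates_inj : injective coordinates.
Proof. exact: (@subm_inj _ _ fin_supp_sm). Qed.

Lemma coordinates_linear a u v x :
  coordinates (a *: u + v) x = a *: coordinates u x + coordinates v x.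
Proof. by rewrite /coordinates linearP. Qed.

Definition coord x (u : dsum) := coordinates u x.
Fact coord_linear x : linear (coord x).
Proof. by move=> a u v; rewrite /coord coordinates_linear. Qed.
HB.instance Definition _ x := GRing.isLinear.Build A dsum V _ (coord x) (coord_linear x).

Lemma dsumP u v : (forall x, coord x u = coord x v) -> u = v.
Proof. by move=> uv; apply: coordinates_inj; apply/funext. Qed.

Lemma dsum_exists (f : X -> V) : fin_supp f -> exists u, forall x, coord x u = f x.
Proof.
by move=> /(@subm_exists _ _ fin_supp_sm)[u uE]; exists u => x; rewrite -uE.
Qed.

Fact dsum_in_sig : {i : X -> {linear V -> dsum} |
  forall x v y, coord y (i x v) = if y == x then v else 0}.
Proof.
apply/cid.
suff /choice[i iE] x : exists i : {linear V -> dsum},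
  forall v y, coord y (i v) = if y == x then v else 0 by exists i.
pose d v y : V := if y == x then v else 0.
have dL : linear d.
  move=> a u v; apply/funext => y; transitivity (a *: d u y + d v y); last by [].
  by rewrite /d; case: ifP; rewrite ?scaler0 ?addr0.
have [v|i iE] := factor_inj (@subm_inj _ _ fin_supp_sm) (f := to_linear dL).
  by apply: subm_exists; exists [:: x] => y; rewrite inE /= /d => /negbTE ->.
by exists i => v y; rewrite /coord /coordinates iE.
Qed.

Definition dsum_in : X -> {linear V -> dsum} := sval dsum_in_sig.

Lemma coord_in x v y : coord y (dsum_in x v) = if y == x then v else 0.
Proof. exact: (svalP dsum_in_sig). Qed.

Lemma coord_sum (I : Type) (r : seq I) (F : I -> dsum) x :
  coord x (\sum_(i <- r) F i) = \sum_(i <- r) coord x (F i).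
Proof. exact: linear_sum. Qed.

Lemma dsum_sum u s : uniq s -> supported s (coordinates u) ->
  u = \sum_(x <- s) dsum_in x (coord x u).
Proof.
move=> us su; apply: dsumP => x; rewrite coord_sum.
under eq_bigr do rewrite coord_in.
have [xs|xs] := boolP (x \in s).
  rewrite (bigD1_seq x) //= eqxx big1 ?addr0 // => y /negbTE.
  by rewrite eq_sym => ->.
rewrite [LHS](su x xs) big_seq big1 // => y ys; case: eqP xs => // ->.
by rewrite ys.
Qed.

End Def.

Section Out.
Variables (V W : lmodType A) (f : X -> {linear V -> W}).

Definition dsum_out (u : dsum V) : W := fsum (fun x => f x (coord x u)).

Fact dsum_out_linear : linear dsum_out.
Proof.
move=> a u v; rewrite /dsum_out.
have F w : fin_supp (fun x => f x (coord x w)).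
  by apply: fin_suppW (coordinatesP w) => x; rewrite /coord => ->; rewrite linear0.
transitivity (fsum (fun x => a *: f x (coord x u) + f x (coord x v))).
  by apply: eq_fsum => x; rewrite !linearP.
rewrite fsumD // -?(@fsum_morph _ _ _ (fun w => a *: w)) //; first exact: scaler0.
  exact: scalerDr.
by apply: fin_suppW (F u) => x ->; rewrite scaler0.
Qed.
HB.instance Definition _ := GRing.isLinear.Build A (dsum V) W _ dsum_out dsum_out_linear.

Lemma dsum_out_in x v : dsum_out (dsum_in V x v) = f x v.
Proof.
rewrite /dsum_out (@fsum_single _ _ _ x); first by rewrite coord_in eqxx.
by move=> y /negbTE yx; rewrite coord_in yx linear0.
Qed.

End Out.

Lemma dsum_ext (V : lmodType A) (W : zmodType) (f g : dsum V -> W) :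
  {morph f : u v / u + v} -> {morph g : u v / u + v} ->
  (forall x v, f (dsum_in V x v) = g (dsum_in V x v)) -> f =1 g.
Proof.
move=> fD gD fg u; have [s us su] := fin_suppP (coordinatesP u).
have D0 (h : dsum V -> W) : {morph h : u v / u + v} -> h 0 = 0.
  by move=> hD; apply: (addrI (h 0)); rewrite -hD !addr0.
rewrite (dsum_sum us su) (big_morph f fD (D0 f fD)) (big_morph g gD (D0 g gD)).
by apply: eq_bigr => x _; apply: fg.
Qed.

Lemma dsum_is_direct_sum (V : lmodType A) : is_direct_sum (@dsum_in V).
Proof.
move=> N f; exists (dsum_out f); split=> [x v|g gE]; first exact: dsum_out_in.
by apply: dsum_ext; [exact: linearD | exact: linearD | move=> x v; rewrite gE /= dsum_out_in].
Qed.

End DirectSums.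

Section Free.
Variable A : pzRingType.

Definition scale_at (V : lmodType A) (v : V) (a : A^o) : V := (a : A) *: v.
Fact scale_at_linear (V : lmodType A) (v : V) : linear (scale_at v).
Proof. by move=> a b c; rewrite /scale_at scalerDl scalerA. Qed.
HB.instance Definition _ (V : lmodType A) (v : V) :=
  GRing.isLinear.Build A A^o V _ (scale_at v) (scale_at_linear v).

Lemma projective_regular : projective_mod (A^o : lmodType A).
Proof.
move=> X Y p f pS; have [m mE] := pS (f 1).
exists (scale_at m) => a; rewrite /= /scale_at linearZ mE -linearZ.
by congr (f _); apply: mulr1.
Qed.

Lemma projective_dsum (X : choiceType) (V : lmodType A) :
  projective_mod V -> projective_mod (dsum X V).
Proof.
move=> Vp M N p f pS.
have /choice[g gE] x := Vp _ _ p (f \o dsum_in V x : {linear _ -> _}) pS.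
exists (dsum_out g).
apply: (@dsum_ext _ _ _ _ (p \o dsum_out g) f); first exact: (linearD (p \o dsum_out g)).
  exact: linearD.
by move=> x v; rewrite /= dsum_out_in gE.
Qed.

Definition free_mod (X : choiceType) : lmodType A := dsum X A^o.
Definition basis (X : choiceType) (x : X) : free_mod X := dsum_in A^o x (1 : A).
Definition linear_comb (X : choiceType) (M : lmodType A) (m : X -> M) :
    {linear free_mod X -> M} := dsum_out (fun x => scale_at (m x)).

Definition fcoord (X : choiceType) (x : X) (u : free_mod X) : A := coord x u.

Lemma fcoordD (X : choiceType) (x : X) (u v : free_mod X) :
  fcoord x (u + v) = fcoord x u + fcoord x v.
Proof. by rewrite /fcoord linearD. Qed.

Lemma fcoordZ (X : choiceType) (x : X) (a : A) (u : free_mod X) :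
  fcoord x (a *: u) = a * fcoord x u.
Proof. by rewrite /fcoord linearZ. Qed.

Lemma fcoord0 (X : choiceType) (x : X) : fcoord x (0 : free_mod X) = 0.
Proof. by rewrite /fcoord linear0. Qed.

Lemma fcoordN (X : choiceType) (x : X) (u : free_mod X) : fcoord x (- u) = - fcoord x u.
Proof. by rewrite /fcoord linearN. Qed.

Lemma fcoord_basis (X : choiceType) (x y : X) : fcoord y (basis x) = (y == x)%:R.
Proof. by rewrite /fcoord coord_in; case: eqP. Qed.

Lemma fcoord_inj (X : choiceType) (u v : free_mod X) :
  (forall x, fcoord x u = fcoord x v) -> u = v.
Proof. by move=> uv; apply: dsumP => x; exact: uv. Qed.

Lemma fcoord_supp (X : choiceType) (u : free_mod X) : fin_supp (fun x => fcoord x u).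
Proof. exact: (@coordinatesP A X A^o u). Qed.

Lemma fcoord_exists (X : choiceType) (f : X -> A) : fin_supp f ->
  exists u : free_mod X, forall x, fcoord x u = f x.
Proof. exact: (@dsum_exists A X A^o). Qed.

Lemma fcoord_sum (X : choiceType) (I : Type) (s : seq I)
    (F : I -> free_mod X) x :
  fcoord x (\sum_(i <- s) F i) = \sum_(i <- s) fcoord x (F i).
Proof. by rewrite /fcoord linear_sum. Qed.

Lemma linear_combE (X : choiceType) (M : lmodType A) (m : X -> M) (u : free_mod X) :
  linear_comb m u = fsum (fun x => fcoord x u *: m x).
Proof. by []. Qed.

Lemma linear_comb_seq (X : choiceType) (N : lmodType A) (h : X -> N)
    (p : free_mod X) (s : seq X) :
  uniq s -> supported s (fun x => fcoord x p) ->
  linear_comb h p = \sum_(x <- s) fcoord x p *: h x.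
Proof.
move=> us sp; rewrite linear_combE (@fsumE _ _ _ s) // => x xs.
by rewrite sp ?scale0r.
Qed.

Lemma linear_comb_basis (X : choiceType) (M : lmodType A) (m : X -> M) x :
  linear_comb m (basis x) = m x.
Proof. by rewrite /linear_comb /= dsum_out_in /= /scale_at scale1r. Qed.

Lemma free_ext (X : choiceType) (V : lmodType A)
    (f g : {linear free_mod X -> V}) :
  (forall x, f (basis x) = g (basis x)) -> f =1 g.
Proof.
move=> fg; apply: dsum_ext; [exact: linearD | exact: linearD | move=> x a].
have -> : dsum_in A^o x a = (a : A) *: basis x.
  by rewrite -linearZ; congr (dsum_in _ x _); exact: esym (mulr1 (a : A)).
by rewrite !linearZ fg.
Qed.

Lemma projective_free (X : choiceType) : projective_mod (free_mod X).
Proof. exact/projective_dsum/projective_regular. Qed.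

Lemma free_cover (M : lmodType A) : surj (linear_comb (fun m : M => m)).
Proof. by move=> m; exists (basis m); rewrite linear_comb_basis. Qed.

Lemma projective_retract_free (P : lmodType A) :
  projective_mod P -> retract_of P (free_mod P).
Proof.
move=> Pp; have [u uE] := Pp _ _ (linear_comb id) idfun (@free_cover P).
by exists u, (linear_comb id).
Qed.

End Free.

(** * Localisation *)

Section Denominators.
Variables (R Q : pzRingType) (iota : {rmorphism R -> Q}).
Hypothesis Qq : is_classical_quotient_ring iota.

Definition denom (s : R) (t : Q) := is_inverse (iota s) t.

Lemma denom1 : denom 1 1.
Proof. by split; rewrite rmorph1 mulr1. Qed.

Lemma denomM s t s' t' : denom s t -> denom s' t' -> denom (s * s') (t' * t).
Proof.
move=> [st ts] [st' ts']; split; rewrite rmorphM.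
  by rewrite mulrA -(mulrA (iota s)) st' mulr1.
by rewrite mulrA -(mulrA t') ts mulr1.
Qed.

Lemma denom_regular s t : denom s t -> regular s.
Proof.
move=> [st ts]; split=> a b eab; apply: (cq_inj Qq).
  by rewrite -[LHS]mul1r -[RHS]mul1r -ts -!mulrA -!rmorphM eab.
by rewrite -[LHS]mulr1 -[RHS]mulr1 -st !mulrA -!rmorphM eab.
Qed.

Lemma regular_denom s : regular s -> exists t, denom s t.
Proof. exact: (cq_inv Qq). Qed.

Lemma right_common_denominator (l : seq Q) :
  exists s t, denom s t /\ forall q, q \in l -> exists a, q = iota a * t.
Proof.
elim: l => [|q0 l [s [t [st IH]]]]; first by exists 1, 1; split=> //; apply: denom1.
have [a0 [s0 [t0 [_ st0 ->]]]] := cq_right Qq q0.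
have [u [v [t' [_ vt' e]]]] := cq_right Qq (t0 * iota s).
exists (s * v), (t' * t); split; first exact: denomM.
move=> q; rewrite inE => /orP[/eqP ->|/IH [a ->]].
  exists (a0 * u); rewrite rmorphM -!mulrA; congr (_ * _).
  by rewrite (mulrA (iota u)) -e -mulrA st.1 mulr1.
by exists (a * v); rewrite rmorphM -!mulrA (mulrA (iota v)) vt'.1 mul1r.
Qed.

Lemma left_common_denominator (l : seq Q) :
  exists s t, denom s t /\ forall q, q \in l -> exists a, q = t * iota a.
Proof.
elim: l => [|q0 l [s [t [st IH]]]]; first by exists 1, 1; split=> //; apply: denom1.
have [a0 [s0 [t0 [_ st0 ->]]]] := cq_left Qq q0.
have [u [v [t' [_ vt' e]]]] := cq_left Qq (iota s * t0).
exists (v * s), (t * t'); split; first exact: denomM.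
move=> q; rewrite inE => /orP[/eqP ->|/IH [a ->]].
  exists (u * a0); rewrite rmorphM !mulrA; congr (_ * _).
  by rewrite -(mulrA t) -e mulrA st.2 mul1r.
by exists (v * a); rewrite rmorphM !mulrA -(mulrA t) vt'.2 mulr1.
Qed.

End Denominators.

(** The type is renamed, as in [restr_right], so that it can carry the action of
    [R] besides that of [Q]. *)
Definition restrict (R Q : pzRingType) (iota : {rmorphism R -> Q})
  (V : rmodType Q) : Type := V.

Section Restrict.
Variables (R Q : pzRingType) (iota : {rmorphism R -> Q}).
Local Notation res := (restrict iota).

Section Def.
Variable V : rmodType Q.

HB.instance Definition _ := GRing.Zmodule.copy (res V) V.

Definition restrict_scale (r : R^c) (v : res V) : res V :=
  (iota r : Q^c) *: (v : V).

Fact restrict_scaleA a b (v : res V) :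
  restrict_scale a (restrict_scale b v) = restrict_scale (a * b) v.
Proof. by rewrite /restrict_scale scalerA rmorphM. Qed.

Fact restrict_scale1 : left_id 1 restrict_scale.
Proof. by move=> v; rewrite /restrict_scale rmorph1 scale1r. Qed.

Fact restrict_scaleDr : right_distributive restrict_scale +%R.
Proof. by move=> a u v; apply: scalerDr. Qed.

Fact restrict_scaleDl (v : res V) : {morph restrict_scale^~ v : a b / a + b}.
Proof. by move=> a b; rewrite /restrict_scale rmorphD; apply: scalerDl. Qed.

HB.instance Definition _ := GRing.Zmodule_isLmodule.Build R^c (res V)
  restrict_scaleA restrict_scale1 restrict_scaleDr restrict_scaleDl.

Lemma restrict_scaleE (r : R) (v : res V) : (r : R^c) *: v = (iota r : Q^c) *: (v : V).
Proof. by []. Qed.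

End Def.

Definition restrict_map (V W : rmodType Q) (f : {linear V -> W}) (v : res V) : res W := f v.
Fact restrict_map_linear (V W : rmodType Q) (f : {linear V -> W}) :
  linear (restrict_map f).
Proof. by move=> a u v; rewrite /restrict_map !restrict_scaleE; exact: linearP. Qed.
HB.instance Definition _ (V W : rmodType Q) (f : {linear V -> W}) :=
  GRing.isLinear.Build R^c (res V) (res W) _ (restrict_map f) (restrict_map_linear f).

Lemma scale_denomK (V : rmodType Q) s t (v : V) : denom iota s t ->
  (t : Q^c) *: ((iota s : Q^c) *: v) = v /\ (iota s : Q^c) *: ((t : Q^c) *: v) = v.
Proof.
move=> [st ts]; rewrite !scalerA; have -> : (t : Q^c) * iota s = 1 by exact: st.
by have -> : (iota s : Q^c) * t = 1 by [exact: ts]; rewrite scale1r.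
Qed.

(** [g (v r s^-1) s = g (v r)], and [s] acts bijectively. *)
Lemma linear_over_quotient (Qq : is_classical_quotient_ring iota)
    (V W : rmodType Q) (g : {linear res V -> res W}) :
  exists h : {linear V -> W}, forall v, h v = g v.
Proof.
suff gL : linear (g : V -> W) by exists (to_linear gL).
have gZ (q : Q^c) (v : V) : g (q *: v) = q *: (g v : W).
  have [r [s [t [_ st ->]]]] := cq_right Qq (q : Q).
  have -> : (iota r * t : Q) = (t : Q^c) * (iota r : Q^c) by [].
  rewrite -!scalerA -restrict_scaleE -(restrict_scaleE r (g v)) -linearZ.
  set w : V := (r : R^c) *: (v : res V).
  have <- : (iota s : Q^c) *: (g ((t : Q^c) *: w) : W) = g w.
    by rewrite -restrict_scaleE -linearZ restrict_scaleE (scale_denomK _ st).2.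
  by rewrite (scale_denomK _ st).1.
by move=> q u v; rewrite -gZ; apply: linearD.
Qed.

End Restrict.

Arguments restrict_map {R Q} iota {V W} f v.

Section Localization.
Variables (R Q : pzRingType) (iota : {rmorphism R -> Q}).
Hypothesis Qq : is_classical_quotient_ring iota.
Local Notation res := (restrict iota).

(** Coordinates in a free right module, read in [T] rather than in [T^c]. *)
Definition rcoord (T : pzRingType) (X : choiceType) (x : X) (u : free_mod T^c X) : T :=
  fcoord x u.

Lemma rcoordD (T : pzRingType) (X : choiceType) (x : X) (u v : free_mod T^c X) :
  rcoord x (u + v) = rcoord x u + rcoord x v.
Proof. exact: (@fcoordD T^c X x u v). Qed.

Lemma rcoordZ (T : pzRingType) (X : choiceType) (x : X) (a : T) (u : free_mod T^c X) :
  rcoord x ((a : T^c) *: u) = rcoord x u * a.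
Proof. exact: (@fcoordZ T^c X x a u). Qed.

Lemma rcoord0 (T : pzRingType) (X : choiceType) (x : X) : rcoord x (0 : free_mod T^c X) = 0.
Proof. exact: (@fcoord0 T^c X x). Qed.

Lemma rcoordN (T : pzRingType) (X : choiceType) (x : X) (u : free_mod T^c X) :
  rcoord x (- u) = - rcoord x u.
Proof. exact: (@fcoordN T^c X x u). Qed.

Lemma rcoord_basis (T : pzRingType) (X : choiceType) (x y : X) :
  rcoord y (basis T^c x) = (y == x)%:R.
Proof. by rewrite /rcoord fcoord_basis; case: eqP. Qed.

Section Def.
Variable F : rmodType R.

(** The [Q]-linear combinations of elements of [F] which, multiplied by a common
    denominator, become [R]-linear combinations vanishing in [F].  This is the span
    of the relations defining [F (x)_R Q], in a form that makes the kernel of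
    [F -> F (x)_R Q] visible. *)
Definition loc_rel : submodule (free_mod Q^c F).
Proof.
exists (fun v => exists s t (w : free_mod R^c F), [/\ denom iota s t,
  forall x, rcoord x v * iota s = iota (rcoord x w) & linear_comb id w = 0]).
  exists 1, 1, 0; split=> [|x|]; first exact: denom1; last exact: linear0.
  by rewrite !rcoord0 mul0r rmorph0.
move=> a u v [s1 [t1 [w1 [st1 uw1 lw1]]]] [s2 [t2 [w2 [st2 vw2 lw2]]]].
have [s [t [st H]]] := right_common_denominator Qq [:: t1 * (a : Q); t2].
have [|b eb] := H (t1 * (a : Q)); first by rewrite inE eqxx.
have [|c ec] := H t2; first by rewrite !inE eqxx orbT.
exists s, t, ((b : R^c) *: w1 + (c : R^c) *: w2); split=> //; last first.
  by rewrite linearD !linearZ /= lw1 lw2 !scaler0 addr0.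
move=> x; rewrite !rcoordD !rcoordZ rmorphD !rmorphM -uw1 -vw2 mulrDl.
congr (_ + _); rewrite -!mulrA; congr (_ * _).
  by rewrite -[LHS]mul1r -st1.1 -!mulrA (mulrA t1) eb -mulrA st.2 mulr1.
by rewrite -[LHS]mul1r -st2.1 -!mulrA ec -!mulrA st.2 mulr1.
Defined.

Definition loc : rmodType Q := quot loc_rel.

Definition loc_map0 (x : F) : res loc := quot_proj loc_rel (basis Q^c x).

Fact loc_map0_linear : linear loc_map0.
Proof.
move=> a x y; apply/subr0_eq; rewrite /loc_map0 restrict_scaleE -linearP -linearB.
apply/quot_proj0; exists 1, 1, (basis R^c (a *: x + y) - (a *: basis R^c x + basis R^c y)).
split=> [|z|]; first exact: denom1.
  rewrite rmorph1 mulr1 !(rcoordD, rcoordN, rcoordZ, rcoord_basis).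
  by rewrite !(rmorphD, rmorphN, rmorphM, rmorph_nat).
by rewrite linearB linearP !linear_comb_basis subrr.
Qed.
HB.instance Definition _ := GRing.isLinear.Build R^c F (res loc) _ loc_map0 loc_map0_linear.

Definition loc_map : {linear F -> res loc} := loc_map0.

Lemma loc_mapZ (r : R) (x : F) :
  loc_map ((r : R^c) *: x) = (iota r : Q^c) *: (loc_map x : loc) :> loc.
Proof. by rewrite -restrict_scaleE -linearZ. Qed.

Lemma loc_map_surj (v : loc) : exists x s t,
  denom iota s t /\ v = (t : Q^c) *: (loc_map x : loc).
Proof.
have [u <-] := @quot_projP _ _ loc_rel v.
have [l ul] := fcoord_supp u.
have [s [t [st H]]] := right_common_denominator Qq [seq rcoord x u | x <- l].
have /choice[a aE] x : exists a, rcoord x u = iota a * t /\ (x \notin l -> a = 0).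
  have [xl|xl] := boolP (x \in l); last first.
    by exists 0; split=> //; rewrite /rcoord ul // rmorph0 mul0r.
  by have [|a ->] := H (rcoord x u); [apply: map_f | exists a].
have [|w wE] := @fcoord_exists R^c F a; first by exists l => x /(aE x).2.
exists (linear_comb id w), s, t; split=> //.
have -> : (t : Q^c) *: (loc_map (linear_comb id w) : loc) =
    quot_proj loc_rel ((t : Q^c) *: basis Q^c (linear_comb id w)) by rewrite linearZ.
apply/subr0_eq; rewrite -linearB; apply/quot_proj0.
exists s, t, (w - basis R^c (linear_comb id w)); split=> //; last first.
  by rewrite linearB linear_comb_basis subrr.
move=> x; rewrite !(rcoordD, rcoordN, rcoordZ) !rcoord_basis {2}/rcoord wE.
rewrite (aE x).1 rmorphB rmorph_nat mulrBl -!mulrA st.2 !mulr1.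
by [].
Qed.

Lemma loc_map_ker (x : F) : loc_map x = 0 ->
  exists s t, denom iota s t /\ (s : R^c) *: x = 0.
Proof.
move=> /quot_proj0 [s [t [w [st xw lw]]]]; exists s, t; split=> //.
rewrite -lw; have -> : w = (s : R^c) *: basis R^c x.
  apply: fcoord_inj => y; apply: (cq_inj Qq); rewrite -[LHS]xw.
  change (rcoord y (basis Q^c x) * iota s = iota (rcoord y ((s : R^c) *: basis R^c x))).
  by rewrite rcoordZ !rcoord_basis rmorphM rmorph_nat.
by rewrite linearZ /= linear_comb_basis.
Qed.

Lemma loc_extend (W : rmodType Q) (f : {linear F -> res W}) :
  exists g : {linear loc -> W}, forall x, g (loc_map x) = f x.
Proof.
have [v|g gE] := factor_surj (f := linear_comb (f : F -> W)) (@quot_projP _ _ loc_rel).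
  move=> /quot_proj0 [s [t [w [st vw lw]]]].
  rewrite -[LHS](scale_denomK _ st).1 -linearZ.
  suff -> : linear_comb (f : F -> W) ((iota s : Q^c) *: v) = f (linear_comb id w).
    by rewrite lw linear0 scaler0.
  rewrite !linear_combE (@fsum_morph _ _ _ f) ?linear0 //; last first.
    by apply: fin_suppW (fcoord_supp w) => x ->; rewrite scale0r.
    exact: linearD.
  apply: eq_fsum => x.
  transitivity ((iota (rcoord x w) : Q^c) *: (f x : W)).
    by rewrite -vw -rcoordZ.
  by rewrite -restrict_scaleE -linearZ.
by exists g => x; rewrite gE linear_comb_basis.
Qed.

Lemma loc_ext (W : rmodType Q) (f g : {linear loc -> W}) :
  (forall x, f (loc_map x) = g (loc_map x)) -> f =1 g.
Proof.
by move=> fg v; have [x [s [t [_ ->]]]] := loc_map_surj v; rewrite !linearZ /= fg.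
Qed.

End Def.

Lemma loc_functor (K P : rmodType R) (i : {linear K -> P}) :
  exists j : {linear loc K -> loc P},
    (forall x, j (loc_map K x) = loc_map P (i x)) /\ (injective i -> injective j).
Proof.
have [j jE] := loc_extend (loc_map P \o i : {linear _ -> _}).
exists j; split=> // iI; apply: inj_of_ker => v.
have [x [s [t [st ->]]]] := loc_map_surj v.
rewrite linearZ jE => /(congr1 (fun u => (iota s : Q^c) *: u)).
rewrite scaler0 (scale_denomK _ st).2 => /loc_map_ker [s' [t' [st']]].
rewrite -linearZ -(linear0 i) => /iI sx0.
have : (iota s' : Q^c) *: (loc_map K x : loc K) = 0.
  by rewrite -restrict_scaleE -linearZ sx0 linear0.
move=> /(congr1 (fun u => (t' : Q^c) *: u)).
by rewrite (scale_denomK _ st').1 !scaler0 => ->; rewrite scaler0.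
Qed.

(** [loc] is left adjoint to the exact functor of restriction to [R]. *)
Lemma projective_loc (F : rmodType R) : projective_mod F -> projective_mod (loc F).
Proof.
move=> Fp M N p f pS.
have [g gE] := Fp (res M) (res N) (restrict_map iota p)
  (restrict_map iota f \o loc_map F : {linear F -> res N}) pS.
have [h hE] := loc_extend g.
exists h; apply: (@loc_ext _ _ (p \o h : {linear _ -> _})) => x.
by rewrite /= hE; apply: gE.
Qed.

End Localization.

(** * Modules over [Q] *)

Lemma projective_dim0 (A : pzRingType) (M : lmodType A) : proj_dim_le 0 M -> projective_mod M.
Proof.
move=> /resolution_dim_le0 [P [p [Pp pI pS]]].
have [g gE] := factor_inj (f := idfun : {linear M -> M}) pI pS.
by apply: projective_retract Pp; exists g, p.
Qed.

(** The cokernel of [j] has projective dimension at most one, hence zero. *)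
Lemma split_of_Fdim_zero (Q : pzRingType) (K P : rmodType Q) (j : {linear K -> P}) :
  right_Fdim_zero Q -> projective_mod K -> projective_mod P -> injective j ->
  exists r : {linear P -> K}, forall x, r (j x) = x.
Proof.
move=> Fd Kp Pp jI; pose C : rmodType Q := quot (range_sm j).
pose q : {linear P -> C} := quot_proj (range_sm j).
have Cp : projective_mod C.
  apply: projective_dim0; have [//|/(_ 1)[]] := Fd C.
  apply: (short_resolution _ Kp Pp jI (@quot_exact _ _ _ j)).
    exact: projective_zero_mod.
  exact: quot_projP.
have [u uE] := Cp _ _ q idfun (@quot_projP _ _ (range_sm j)).
have [x|r rE] := factor_inj jI (f := (idfun \- (u \o q) : {linear _ -> _})).
  by apply/(@quot_exact _ _ _ j); rewrite linearB /= uE subrr.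
exists r => x; apply: jI; rewrite rE /=.
have -> : q (j x) = 0 by apply/(@quot_exact _ _ _ j); exists x.
by rewrite linear0 subr0.
Qed.

Section MatlisCotorsion.
Variables (R Q : pzRingType) (iota : {rmorphism R -> Q}).
Hypothesis Qq : is_classical_quotient_ring iota.
Local Notation res := (restrict iota).
Local Notation Q_R := (restr_right iota : rmodType R).

Lemma restr_rightE (r : R) (q : Q_R) : (r : R^c) *: q = (q : Q) * iota r :> Q.
Proof. by []. Qed.

Definition orbit_map (V : rmodType Q) (v : V) (q : Q_R) : res V := ((q : Q) : Q^c) *: v.
Fact orbit_map_linear (V : rmodType Q) (v : V) : linear (orbit_map v).
Proof.
move=> a p q; rewrite /orbit_map restrict_scaleE [in LHS]scalerDl; congr (_ + _).
by rewrite restr_rightE scalerA.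
Qed.
HB.instance Definition _ (V : rmodType Q) (v : V) :=
  GRing.isLinear.Build R^c Q_R (res V) _ (orbit_map v) (orbit_map_linear v).

Definition quotient_regular (q : Q_R) : res (Q^c)^o := q.
Fact quotient_regular_linear : linear quotient_regular.
Proof. by []. Qed.
HB.instance Definition _ :=
  GRing.isLinear.Build R^c Q_R (res (Q^c)^o) _ quotient_regular quotient_regular_linear.

Definition iota_map (r : (R^c)^o) : Q_R := iota r.
Fact iota_map_linear : linear iota_map.
Proof. by move=> a x y; rewrite /iota_map rmorphD rmorphM. Qed.
HB.instance Definition _ :=
  GRing.isLinear.Build R^c (R^c)^o Q_R _ iota_map iota_map_linear.

(** Regular elements act bijectively on an extension [E] of [Q] by [C], so that [E]
    is its own localisation; a preimage [e] of [1] then gives the section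
    [q |-> e q]. *)
Lemma Matlis_cotorsion_restrict (C : rmodType Q) : Matlis_cotorsion iota (res C).
Proof.
apply: Ext1_zeroP => E.
pose i := ext_inj E; pose p := ext_proj E.
have ip : exact_at i p := @ext_exactP _ _ _ E.
have lI : injective (loc_map Qq (ext_mid E)).
  apply: inj_of_ker => x /loc_map_ker [s [t [st sx]]].
  have px : p x = 0.
    have : (p x : Q) * iota s = 0 by rewrite -restr_rightE -linearZ sx linear0.
    by move=> /(congr1 (fun q => q * t)); rewrite -mulrA st.1 mulr1 mul0r.
  have [c cx] := (ip x).1 px; move: sx; rewrite -cx -linearZ -(linear0 i).
  move=> /(@ext_injP _ _ _ E); rewrite restrict_scaleE.
  move=> /(congr1 (fun u : C => (t : Q^c) *: u)).
  by rewrite (scale_denomK _ st).1 scaler0 => ->.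
have lS v : exists x, loc_map Qq (ext_mid E) x = v.
  have [x [s [t [st ->]]]] := loc_map_surj v.
  have [y py] := @ext_projP _ _ _ E ((p x : Q) * t).
  have [c cE] : exists c, i c = (s : R^c) *: y - x.
    by apply/ip; rewrite linearB linearZ /= py restr_rightE -mulrA st.2 mulr1 subrr.
  exists (y - i ((t : Q^c) *: (c : C))).
  have <- : (s : R^c) *: (y - i ((t : Q^c) *: (c : C))) = x.
    rewrite scalerBr -linearZ restrict_scaleE (scale_denomK _ st).2.
    by rewrite cE opprB addrC subrK.
  by rewrite loc_mapZ (scale_denomK _ st).1.
have [e pe] := @ext_projP _ _ _ E (1 : Q).
pose e' : loc Qq (ext_mid E) := loc_map Qq (ext_mid E) e.
have [q|g gE] := factor_inj lI (f := orbit_map e').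
  exact: lS.
exists g => q.
have [pi piE] := loc_extend Qq (quotient_regular \o p : {linear _ -> _}).
transitivity (pi (loc_map Qq _ (g q))); first by rewrite piE.
rewrite gE /orbit_map /= linearZ piE /= /p pe.
exact: mul1r.
Qed.

Lemma restrict_free (X : choiceType) :
  exists k : {linear res (free_mod Q^c X) -> dsum X Q_R},
    forall x u, coord x (k u) = rcoord x u.
Proof.
pose c (u : res (free_mod Q^c X)) : X -> Q_R := fun x => rcoord x u.
have cL : linear c.
  move=> a u v; apply/funext => x; rewrite /c restrict_scaleE rcoordD rcoordZ.
  by [].
have [u|k kE] := factor_inj (@subm_inj _ _ (fin_supp_sm X Q_R)) (f := to_linear cL).
  by apply: subm_exists; exact: (@coordinatesP Q^c X (Q^c)^o u).
by exists k => x u; rewrite /coord /coordinates kE.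
Qed.

Lemma restrict_free_out (X : choiceType) (E : rmodType R) (g : X -> {linear Q_R -> E}) :
  exists G : {linear res (free_mod Q^c X) -> E},
    forall x q, G ((q : Q^c) *: basis Q^c x) = g x q.
Proof.
have [k kE] := restrict_free X.
exists (dsum_out g \o k : {linear _ -> _}) => x q.
rewrite -(dsum_out_in g x (q : Q_R)) /=; congr (dsum_out g _).
apply: dsumP => y; rewrite kE coord_in rcoordZ rcoord_basis.
by case: eqP; rewrite ?mul1r ?mul0r.
Qed.

(** Extensions of a projective [Q]-module split as soon as those of [Q] do:
    a splitting is assembled from lifts of the maps [q |-> v q]. *)
Lemma projective_restrict_strongly_flat (V : rmodType Q) :
  projective_mod V -> strongly_flat iota (res V).
Proof.
move=> Vp C Cm; apply: Ext1_zeroP => E.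
have /choice[g gE] v := Ext1_lift (orbit_map (v : V)) Cm
  (@ext_injP _ _ _ E) (@ext_exactP _ _ _ E) (@ext_projP _ _ _ E).
have [G GE] := restrict_free_out g.
have [u uE] := Vp _ _ (linear_comb id) idfun (@free_cover _ V).
exists (G \o restrict_map iota u : {linear _ -> _}) => v /=.
rewrite -[RHS]uE /restrict_map; move: (u v) => {v}w.
apply: (@dsum_ext _ _ _ _ (ext_proj E \o G) (linear_comb (id : V -> V))).
- exact: (linearD (ext_proj E \o G)).
- exact: linearD.
move=> v q; have -> : dsum_in (Q^c)^o v q = (q : Q^c) *: basis Q^c v.
  by rewrite -linearZ; congr (dsum_in _ v _); exact: esym (mulr1 (q : Q^c)).
by rewrite [LHS]/= GE gE linearZ linear_comb_basis.
Qed.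

End MatlisCotorsion.

(** * Flat modules *)

Definition to_additive (M N : zmodType) (f : M -> N) (fA : zmod_morphism f) :
    {additive M -> N} :=
  HB.pack f (GRing.isZmodMorphism.Build M N f fA).

Section AdditiveQuotients.
Variable M : zmodType.

Lemma additive_quotient (P : M -> Prop) : P 0 ->
  (forall u v, P u -> P v -> P (u + v)) -> (forall u, P u -> P (- u)) ->
  exists (T : zmodType) (p : {additive M -> T}), surj p /\ forall x, p x = 0 <-> P x.
Proof.
move=> P0 PD PN.
have PL (a : int) (u v : zmodule M) : P u -> P v -> P (a *: u + v).
  move=> Pu Pv; apply: (PD) => //.
  have Pn n : P (u *+ n) by elim: n => [|n IH]; rewrite ?mulr0n // mulrS; apply: (PD).
  by case: a => n; [exact: Pn | apply: PN; exact: (Pn n.+1)].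
pose U : submodule (zmodule M) := Submodule P0 PL.
have pA : zmod_morphism (quot_proj U : M -> quot U) by move=> x y; exact: linearB.
exists (quot U), (to_additive pA).
by split; [exact: (@quot_projP _ _ U) | exact: (@quot_proj0 _ _ U)].
Qed.

End AdditiveQuotients.

Lemma factor_additive (M N Z : zmodType) (p : {additive M -> N}) (f : M -> Z) :
  {morph f : x y / x + y} -> surj p -> (forall x, p x = 0 -> f x = 0) ->
  exists g : {additive N -> Z}, forall x, g (p x) = f x.
Proof.
move=> fD /choice[s ps] pf.
have f0 : f 0 = 0 by apply: (addrI (f 0)); rewrite -fD !addr0.
have fB x y : f (x - y) = f x - f y.
  by apply: (addIr (f y)); rewrite -fD !subrK.
have gE x : f (s (p x)) = f x.
  by apply/subr0_eq; rewrite -fB; apply: pf; rewrite raddfB /= ps subrr.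
have gA : zmod_morphism (f \o s).
  by move=> u v; rewrite /= -{1}[u]ps -{1}[v]ps -raddfB gE fB.
by exists (to_additive gA).
Qed.

Section FlatTheory.
Variable R : pzRingType.
Implicit Types (M : rmodType R) (N : lmodType R).

(** The equational criterion of flatness, for finite systems of relations. *)
Definition eq_flat M := forall (I K : finType) (m : I -> M) (r : I -> K -> R),
  (forall k, \sum_i (r i k : R^c) *: m i = 0) ->
  exists (J : finType) (z : J -> M) (a : J -> I -> R),
    (forall i, m i = \sum_j (a j i : R^c) *: z j) /\
    (forall j k, \sum_i a j i * r i k = 0).

Section Balanced.
Variables (M : rmodType R) (N : lmodType R) (T : zmodType) (t : M -> N -> T).
Hypothesis tb : balanced t.

Lemma balancedDl m m' n : t (m + m') n = t m n + t m' n. Proof. by case: tb. Qed.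
Lemma balancedDr m n n' : t m (n + n') = t m n + t m n'. Proof. by case: tb. Qed.
Lemma balancedZ m (r : R) n : t ((r : R^c) *: m) n = t m (r *: n). Proof. by case: tb. Qed.
Lemma balanced0l n : t 0 n = 0.
Proof. by apply: (addrI (t 0 n)); rewrite -balancedDl !addr0. Qed.
Lemma balanced0r m : t m 0 = 0.
Proof. by apply: (addrI (t m 0)); rewrite -balancedDr !addr0. Qed.
Lemma balanced_suml (I : Type) (s : seq I) (F : I -> M) n :
  t (\sum_(i <- s) F i) n = \sum_(i <- s) t (F i) n.
Proof. by apply: (big_morph (t^~ n)) => [x y|]; [exact: balancedDl | exact: balanced0l]. Qed.
Lemma balanced_sumr (I : Type) (s : seq I) (F : I -> N) m :
  t m (\sum_(i <- s) F i) = \sum_(i <- s) t m (F i).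
Proof. by apply: (big_morph (t m)) => [x y|]; [exact: balancedDr | exact: balanced0r]. Qed.

End Balanced.

(** The quotient of [T] by the sums of pure tensors receives the projection and
    the zero map, which agree on pure tensors. *)
Lemma tensor_generated M N (T : zmodType) (t : M -> N -> T) : is_tensor t ->
  forall u, exists (I : finType) (m : I -> M) (n : I -> N), u = \sum_i t (m i) (n i).
Proof.
move=> [tb tu].
pose G (u : T) := exists (I : finType) (m : I -> M) (n : I -> N), u = \sum_i t (m i) (n i).
have G0 : G 0 by exists void, (fun _ => 0), (fun _ => 0); rewrite big_pred0 // => -[].
have GD u v : G u -> G v -> G (u + v).
  move=> [I1 [m1 [n1 ->]]] [I2 [m2 [n2 ->]]].
  exists (I1 + I2)%type, (fun i => match i with inl i => m1 i | inr i => m2 i end).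
  exists (fun i => match i with inl i => n1 i | inr i => n2 i end).
  by rewrite big_sumType.
have GN u : G u -> G (- u).
  move=> [I [m [n ->]]]; exists I, (fun i => - m i), n; rewrite -sumrN.
  apply: eq_bigr => i _; apply/eqP; rewrite eq_sym -addr_eq0 -(balancedDl tb) addNr.
  by rewrite (balanced0l tb).
have [V [p [pS p0]]] := additive_quotient G0 GD GN.
have [|g [g0 gu]] := tu _ (fun _ _ => 0 : V).
  by split=> *; rewrite ?addr0.
move=> u; apply/(p0 u); rewrite (gu p); last first.
  move=> m n; apply/(p0 (t m n)); exists unit, (fun _ => m), (fun _ => n).
  by rewrite (big_pred1 tt) // => -[].
by rewrite -(gu (\0 : {additive T -> V})).
Qed.

(** [M (x) N], for [N] the submodule of [R^K] spanned by the rows of [r], is [M^I]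
    modulo [M] times the left syzygies of [r].  Flatness embeds it into [M^K], where
    the class of [m] vanishes by assumption. *)
Lemma flat_eq_flat M : flat_mod M -> eq_flat M.
Proof.
move=> Mf I K m r rm0.
pose row (a : I -> R) : K -> R^o := fun k => \sum_i a i * r i k.
have row0 : exists a, row a = 0.
  by exists (fun=> 0); apply/funext => k; rewrite /row big1 // => i _; rewrite mul0r.
have rowD a a' : row a + row a' = row (fun i => a i + a' i).
  apply/funext => k; transitivity (row a k + row a' k); first by [].
  by rewrite /row -big_split /=; apply: eq_bigr => i _; rewrite mulrDl.
have rowZ c a : c *: row a = row (fun i => c * a i).
  apply/funext => k; transitivity (c * row a k); first by [].
  by rewrite /row mulr_sumr; apply: eq_bigr => i _; rewrite mulrA.
have rowL c u v : (exists a, row a = u) -> (exists a, row a = v) ->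
    exists a, row a = c *: u + v.
  by move=> [a <-] [a' <-]; rewrite rowZ rowD; eexists.
pose rows := Submodule row0 rowL; pose incl := subm_incl rows.
(* T is the tensor product of M with the row space *)
pose G (w : I -> M) := exists (J : finType) (z : J -> M) (a : J -> I -> R),
  (forall i, w i = \sum_j (a j i : R^c) *: z j) /\ forall j, row (a j) = 0.
have G0 : G 0.
  exists void, (fun=> 0), (fun _ _ => 0); split=> [i|[]].
  by rewrite big_pred0 // => -[].
have GD u v : G u -> G v -> G (u + v).
  move=> [J1 [z1 [a1 [u1 r1]]]] [J2 [z2 [a2 [u2 r2]]]].
  exists (J1 + J2)%type, (fun i => match i with inl i => z1 i | inr i => z2 i end).
  exists (fun i => match i with inl i => a1 i | inr i => a2 i end).
  split=> [i|[]] //; rewrite big_sumType /= -u1 -u2; exact: erefl.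
have GN u : G u -> G (- u).
  move=> [J [z [a [uE ra]]]]; exists J, (fun j => - z j), a; split=> // i.
  transitivity (- u i); first by [].
  by rewrite uE -sumrN; apply: eq_bigr => j _; rewrite scalerN.
have [T [p [pS p0]]] := additive_quotient G0 GD GN.
pose cl (x : M) (a : I -> R) : T := p (fun i => (a i : R^c) *: x).
have clE x a b : row a = row b -> cl x a = cl x b.
  move=> eab; apply/subr0_eq; rewrite /cl -raddfB; apply/p0.
  exists unit, (fun=> x), (fun _ i => a i - b i); split=> [i|_].
    by rewrite (big_pred1 tt); [rewrite scalerBl | case].
  have <- : row a - row b = 0 by rewrite eab subrr.
  apply/funext => k; transitivity (row a k - row b k); last by [].
  by rewrite /row -sumrB; apply: eq_bigr => i _; rewrite mulrBl.
have /choice[al alE] n : exists a, row a = incl n by exact: (submP n).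
pose t (x : M) (n : subm rows) : T := cl x (al n).
have tb : balanced t.
  split=> [x x' n|x n n'|x c n].
  - rewrite /t /cl -raddfD; congr (p _); apply/funext => i; exact: scalerDr.
  - rewrite /t (@clE x _ (fun i => al n i + al n' i)).
      by rewrite /cl -raddfD; congr (p _); apply/funext => i; exact: scalerDl.
    by rewrite -rowD !alE linearD.
  - rewrite /t (@clE x (al (c *: n)) (fun i => c * al n i)).
      by rewrite /cl; congr (p _); apply/funext => i; rewrite scalerA.
    by rewrite -rowZ !alE linearZ.
have /choice[rho rhoE] i : exists n, incl n = r i.
  apply: (@subm_exists _ _ rows); exists (fun j => (j == i)%:R); apply/funext => k.
  rewrite /row (bigD1 i) //= eqxx mul1r big1 ?addr0 // => j /negbTE ->.
  by rewrite mul0r.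
have inclE a : incl (\sum_i a i *: rho i) = row a.
  apply/funext => k; rewrite linear_sum fct_sumE /row; apply: eq_bigr => i _.
  by rewrite linearZ rhoE.
have wE (w : I -> M) : p w = \sum_i t (w i) (rho i).
  transitivity (\sum_i p (fun j => if j == i then w i else 0)).
    rewrite -raddf_sum; congr (p _); apply/funext => j; rewrite fct_sumE.
    by rewrite (bigD1 j) //= eqxx big1 ?addr0 // => i /negbTE; rewrite eq_sym => ->.
  apply: eq_bigr => i _; rewrite /t (@clE _ _ (fun j => (j == i)%:R)).
    by congr (p _); apply/funext => j; case: eqP; rewrite ?scale1r ?scale0r.
  rewrite alE rhoE; apply/funext => k.
  rewrite /row (bigD1 i) //= eqxx mul1r big1 ?addr0 // => j /negbTE ->.
  by rewrite mul0r.
have tt_ : is_tensor t.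
  split=> // A b bb.
  have bD : {morph (fun w : I -> M => \sum_i b (w i) (rho i)) : u v / u + v}.
    by move=> u v; rewrite -big_split; apply: eq_bigr => i _; rewrite /= (balancedDl bb).
  have [w /p0 [J [z [a [wz ra]]]]|g gE] := factor_additive bD pS.
    under eq_bigr => i _ do rewrite wz (balanced_suml bb).
    rewrite exchange_big big1 //= => j _.
    under eq_bigr => i _ do rewrite (balancedZ bb).
    rewrite -(balanced_sumr bb); have -> : \sum_i a j i *: rho i = 0.
      by apply: (@subm_inj _ _ rows); rewrite linear0 -/incl inclE ra.
    by rewrite (balanced0r bb).
  exists g; split=> [x n|g' g'E u].
    rewrite /t gE.
    under eq_bigr => i _ do rewrite (balancedZ bb).
    rewrite -(balanced_sumr bb); congr (b x _).
    by apply: (@subm_inj _ _ rows); rewrite -/incl inclE.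
  have [w <-] := pS u; rewrite gE wE raddf_sum.
  by apply: eq_bigr => i _; rewrite g'E.
(* the function group K -> M is the tensor product of M with R^K *)
pose t' (x : M) (v : K -> R^o) : K -> M := fun k => ((v k : R) : R^c) *: x.
have tb' : balanced t'.
  split=> [x x' n|x n n'|x c n]; apply/funext => k; rewrite /t'.
  - exact: scalerDr.
  - exact: scalerDl.
  - by rewrite scalerA.
pose e k : K -> R^o := fun l => (l == k)%:R.
have eE (v : K -> R^o) : v = \sum_k v k *: e k.
  apply/funext => k; rewrite fct_sumE (bigD1 k) //= big1 ?addr0.
    by transitivity (v k * (k == k)%:R); [rewrite eqxx mulr1 | ].
  move=> l /negbTE lk; transitivity (v l * (k == l)%:R); first by [].
  by rewrite eq_sym lk mulr0.
have tt' : is_tensor t'.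
  split=> // A b bb.
  have bA : zmod_morphism (fun w : K -> M => \sum_k b (w k) (e k)).
    move=> u v; rewrite -sumrB; apply: eq_bigr => k _; apply/eqP.
    by rewrite eq_sym subr_eq -(balancedDl bb) subrK.
  exists (to_additive bA); split=> [x v|g' g'E w] /=.
    under eq_bigr => i _ do rewrite (balancedZ bb).
    by rewrite -(balanced_sumr bb) -eE.
  have {1}-> : w = \sum_k t' (w k) (e k).
    apply/funext => k; rewrite fct_sumE (bigD1 k) //= big1 ?addr0.
      by rewrite /t' /e eqxx scale1r.
    by move=> l /negbTE lk; rewrite /t' /e eq_sym lk scale0r.
  by rewrite raddf_sum; apply: eq_bigr => k _; rewrite g'E.
have [|g [gE _]] := tt_.2 _ (fun x n => t' x (incl n)).
  split=> [x x' n|x n n'|x c n]; first exact: (balancedDl tb').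
    by rewrite linearD (balancedDr tb').
  by rewrite linearZ (balancedZ tb').
have gI := Mf _ _ incl (@subm_inj _ _ rows) _ _ _ _ tt_ tt' g gE.
have /p0 [J [z [a [mE ra]]]] : p m = 0.
  apply: gI; rewrite raddf0 wE raddf_sum; apply/funext => k.
  rewrite fct_sumE -[RHS](rm0 k); apply: eq_bigr => i _.
  by rewrite gE rhoE.
by exists J, z, a; split=> // j k; exact: (congr1 (fun v => v k) (ra j)).
Qed.

End FlatTheory.

Section EquationalCriterion.
Variable R : pzRingType.
Implicit Types (M : rmodType R) (N : lmodType R).

(** The coordinates of [l] pull back along [f], and [f] sends the value of the
    combination obtained on [N] to the value of [l]. *)
Lemma syzygy_pullback N N' (f : {linear N -> N'}) (l : free_mod R N') :
  injective f -> linear_comb id l = 0 ->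
  (forall n', (forall n, f n != n') -> fcoord n' l = 0) ->
  exists2 u : free_mod R N, linear_comb id u = 0 & forall n, fcoord n u = fcoord (f n) l.
Proof.
move=> fI l0 lout.
have [|u uE] := @fcoord_exists R N (fun n => fcoord (f n) l).
  have [s sl] := fcoord_supp l.
  have /choice[h hE] n' : exists o : option N, forall n, f n = n' -> o = Some n.
    have [[n fn]|nn] := pselect (exists n, f n = n').
      by exists (Some n) => m fm; congr Some; apply: fI; rewrite fm fn.
    by exists None => n fn; case: nn; exists n.
  exists (pmap h s) => n; rewrite mem_pmap => ns; apply: sl.
  by apply: contra ns => ns; apply/mapP; exists (f n) => //; rewrite (hE (f n) n).
exists u => //; apply: (fI); rewrite linear0 -l0.
pose w := linear_comb (fun n => basis R (f n)) u.
have wl : w = l.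
  apply: fcoord_inj => n'.
  have wE : fcoord n' w = fsum (fun n => fcoord n u * (n' == f n)%:R).
    rewrite /w linear_combE (@fsum_morph _ _ _ (fun v : free_mod R N' => fcoord n' v)).
    - by apply: eq_fsum => n; rewrite fcoordZ fcoord_basis.
    - exact: fcoord0.
    - exact: fcoordD.
    - by apply: fin_suppW (fcoord_supp u) => n ->; rewrite scale0r.
  have [[n fn]|nn] := pselect (exists n, f n = n').
    rewrite wE (@fsum_single _ _ _ n) ?fn ?eqxx ?mulr1 ?uE ?fn // => m mn.
    case: eqP => [e|]; last by rewrite mulr0.
    by move: mn; rewrite (fI m n) ?eqxx // -e.
  rewrite wE lout; last by move=> n; apply/eqP => fn; case: nn; exists n.
  rewrite (@fsumE _ _ _ [::]) ?big_nil // => n _.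
  by case: eqP => [e|]; [case: nn; exists n | rewrite mulr0].
rewrite -wl /w.
apply: (@free_ext _ _ _ (f \o linear_comb id : {linear _ -> _})
  (linear_comb id \o linear_comb (fun n => basis R (f n)) : {linear _ -> _})) => n.
by rewrite /= !linear_comb_basis.
Qed.

(** If [sum_i m i (x) f (n i) = 0], then [sum_i m i . f (n i) = sum_j y j . l j] with
    syzygies [l j] of [N'].  Outside the image of [f] the left side vanishes, so
    the coordinates of the [l j] there are relations between the [y j]; solving
    them replaces the [l j] by syzygies supported in the image of [f], which come
    from [N]. *)
Lemma eq_flat_flat M : eq_flat M -> flat_mod M.
Proof.
move=> Me N N' f fI T T' t t' tt_ tt' g gE.
suff g0 z : g z = 0 -> z = 0.
  by move=> x y gxy; apply/subr0_eq/g0; rewrite raddfB /= gxy subrr.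
have [I [m [n ->]]] := tensor_generated tt_ z.
rewrite raddf_sum; under eq_bigr => i _ do rewrite gE; move=> {}z.
(* S is the group of functions N' -> M modulo M times the syzygies of N';
   M (x) N' is the subgroup of the finitely supported ones *)
pose G (w : N' -> M) := exists (J : finType) (z : J -> M) (l : J -> free_mod R N'),
  (forall j, linear_comb id (l j) = 0) /\
  forall n', w n' = \sum_j (fcoord n' (l j) : R^c) *: z j.
have G0 : G 0.
  by exists void, (fun=> 0), (fun=> 0); split=> [|i]; rewrite // big_pred0 // => -[].
have GD u v : G u -> G v -> G (u + v).
  move=> [J1 [z1 [l1 [u1 r1]]]] [J2 [z2 [l2 [u2 r2]]]].
  exists (J1 + J2)%type, (fun i => match i with inl i => z1 i | inr i => z2 i end).
  exists (fun i => match i with inl i => l1 i | inr i => l2 i end).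
  by split=> [[]|n'] //; rewrite big_sumType /= -r1 -r2; exact: erefl.
have GN u : G u -> G (- u).
  move=> [J [y [l [l0 uE]]]]; exists J, (fun j => - y j), l; split=> // n'.
  transitivity (- u n'); first by [].
  by rewrite uE -sumrN; apply: eq_bigr => j _; rewrite scalerN.
have [S [p [pS p0]]] := additive_quotient G0 GD GN.
pose d (x : M) (n' : N') : N' -> M := fun k => if k == n' then x else 0.
have db : balanced (fun x n' => p (d x n')).
  split=> [x x' n'|x n1 n2|x r n'].
  - rewrite -raddfD; congr (p _); apply/funext => k.
    transitivity (d x n' k + d x' n' k); last by [].
    by rewrite /d; case: ifP; rewrite ?addr0.
  - apply/subr0_eq; rewrite -raddfD -raddfB; apply/p0.
    exists unit, (fun=> x), (fun=> basis R (n1 + n2) - (basis R n1 + basis R n2)).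
    split=> [_|k].
      by rewrite linearB linearD !linear_comb_basis subrr.
    rewrite (big_pred1 tt); last by case.
    transitivity (d x (n1 + n2) k - (d x n1 k + d x n2 k)); first by [].
    rewrite /d !(fcoordD, fcoordN) !fcoord_basis !(scalerDl, scaleNr).
    by do !case: eqP; rewrite ?scale1r ?scale0r.
  - apply/subr0_eq; rewrite -raddfB; apply/p0.
    exists unit, (fun=> x), (fun=> r *: basis R n' - basis R (r *: n')); split=> [_|k].
      by rewrite linearB linearZ !linear_comb_basis subrr.
    rewrite (big_pred1 tt); last by case.
    transitivity (d ((r : R^c) *: x) n' k - d x (r *: n') k); first by [].
    rewrite /d !(fcoordD, fcoordN, fcoordZ) !fcoord_basis !(scalerDl, scaleNr).
    by do !case: eqP; rewrite ?mulr1 ?mulr0 ?scale1r ?scale0r.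
have [h [hE _]] := tt'.2 _ _ db.
have /p0 [J [y [l [l0 yE]]]] : p (\sum_i d (m i) (f (n i))) = 0.
  rewrite raddf_sum -[RHS](raddf0 h) -z raddf_sum.
  by apply: eq_bigr => i _; rewrite hE.
have [s [us sl]] := common_support (fun j => fcoord_supp (l j)).
pose outside n' := `[< forall k, f k != n' >].
pose r (j : J) (k : 'I_(size s)) : R :=
  let n' := tnth (in_tuple s) k in if outside n' then fcoord n' (l j) else 0.
have dE n' : (\sum_i d (m i) (f (n i))) n' = \sum_i d (m i) (f (n i)) n'.
  by rewrite fct_sumE.
have [k|J2 [q [c [yq cr]]]] := Me _ _ y r.
  have [out|out] := boolP (outside (tnth (in_tuple s) k)); last first.
    by rewrite big1 // => j _; rewrite /r (negbTE out) scale0r.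
  under eq_bigr => j _ do rewrite /r out.
  rewrite -[LHS](yE (tnth (in_tuple s) k)) dE big1 // => i _; rewrite /d.
  by have /negbTE := elimT (asboolP _) out (n i); rewrite eq_sym => ->.
pose l2 a : free_mod R N' := \sum_j c a j *: l j.
have [u u0 uE] : exists2 u : J2 -> free_mod R N, forall a, linear_comb id (u a) = 0 &
    forall a k, fcoord k (u a) = fcoord (f k) (l2 a).
  suff /choice[u uE] a : exists u : free_mod R N, linear_comb id u = 0 /\
      forall k, fcoord k u = fcoord (f k) (l2 a).
    by exists u => [a|a k]; [exact: (uE a).1 | exact: (uE a).2].
  have [||u u0 uE] := @syzygy_pullback _ _ f (l2 a) fI; last by exists u.
    by rewrite linear_sum big1 // => j _; rewrite linearZ /= l0 scaler0.
  move=> n' out; rewrite fcoord_sum.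
  under eq_bigr => j _ do rewrite fcoordZ.
  have [ns|ns] := boolP (n' \in s); last first.
    by rewrite big1 // => j _; rewrite (sl j) ?mulr0.
  have /tnthP[k kE] : n' \in in_tuple s by [].
  rewrite -[RHS](cr a k); apply: eq_bigr => j _; rewrite /r -kE.
  by have -> : outside n' by apply/asboolP.
have key k : \sum_i (if k == n i then m i else 0) = \sum_a (fcoord k (u a) : R^c) *: q a.
  transitivity ((\sum_i d (m i) (f (n i))) (f k)).
    by rewrite dE; apply: eq_bigr => i _; rewrite /d (inj_eq fI).
  rewrite yE; under eq_bigr => j _ do rewrite yq scaler_sumr.
  rewrite exchange_big; apply: eq_bigr => a _.
  rewrite uE fcoord_sum scaler_suml; apply: eq_bigr => j _.
  by rewrite scalerA fcoordZ.
have [s1 [us1 su]] := common_support (fun a => fcoord_supp (u a)).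
pose s2 := undup (s1 ++ [seq n i | i <- enum I]).
have us2 : uniq s2 by apply: undup_uniq.
have tb := tt_.1.
transitivity (\sum_(k <- s2) t (\sum_i (if k == n i then m i else 0)) k).
  under [RHS]eq_bigr => k _ do rewrite (balanced_suml tb).
  rewrite exchange_big; apply: eq_bigr => i _.
  rewrite (bigD1_seq (n i)) //=; last first.
    by rewrite mem_undup mem_cat map_f ?orbT // mem_enum.
  rewrite eqxx big1 ?addr0 // => k /negbTE ->; exact: (balanced0l tb).
under eq_bigr => k _ do rewrite key (balanced_suml tb).
rewrite exchange_big big1 // => a _.
under eq_bigr => k _ do rewrite (balancedZ tb).
rewrite -(balanced_sumr tb); have -> : \sum_(k <- s2) fcoord k (u a) *: k = 0.
  rewrite -[RHS](u0 a) linear_combE (@fsumE _ _ _ s2) // => k ks.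
  rewrite (su a) ?scale0r //; apply: contra ks => ks.
  by rewrite mem_undup mem_cat ks.
exact: (balanced0r tb).
Qed.

Lemma eq_flat_retract (M M' : rmodType R) : retract_of M M' -> eq_flat M' -> eq_flat M.
Proof.
move=> [u [w wu]] Me I K m r rm.
have [k|J [z [a [mE ar]]]] := Me I K (fun i => u (m i)) r.
  by under eq_bigr => i _ do rewrite -linearZ; rewrite -linear_sum rm linear0.
exists J, (fun j => w (z j)), a; split=> // i.
by rewrite -[LHS]wu mE linear_sum; apply: eq_bigr => j _; rewrite linearZ.
Qed.

Lemma eq_flat_free (X : choiceType) : eq_flat (free_mod R^c X).
Proof.
move=> I K m r rm.
have [s [us su]] := common_support (fun i => fcoord_supp (m i)).
exists 'I_(size s), (fun j => basis R^c (tnth (in_tuple s) j)).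
exists (fun j i => rcoord (tnth (in_tuple s) j) (m i)); split=> [i|j k].
  have e : supported s (coordinates (m i)) by exact: (su i).
  rewrite {1}(dsum_sum us e) (big_tnth _ _ s) /=; apply: eq_bigr => j _.
  rewrite -linearZ; congr (dsum_in _ _ _); exact: (esym (mulr1 (_ : R^c))).
transitivity (rcoord (tnth (in_tuple s) j) (\sum_i (r i k : R^c) *: m i)).
  2: by rewrite rm rcoord0.
rewrite [RHS]fcoord_sum; apply: eq_bigr => i _.
by rewrite -rcoordZ.
Qed.

Lemma flat_projective M : projective_mod M -> flat_mod M.
Proof.
move=> Mp; apply: eq_flat_flat.
exact: (eq_flat_retract (projective_retract_free Mp)) (@eq_flat_free _).
Qed.

(** Relations in [K] are solved by elements [z j] of [P].  The coefficients of the
    solution are relations between their images in [F]; solving these and lifting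
    the solution corrects the [z j] into elements of [K]. *)
Lemma flat_kernel (K P F : rmodType R) (i : {linear K -> P}) (p : {linear P -> F}) :
  flat_mod P -> flat_mod F -> injective i -> exact_at i p -> surj p -> flat_mod K.
Proof.
move=> /flat_eq_flat Pe /flat_eq_flat Fe iI ip pS; apply: eq_flat_flat => I L m r rm.
have [l|J [z [a [mE ar]]]] := Pe I L (fun x => i (m x)) r.
  by under eq_bigr => x _ do rewrite -linearZ; rewrite -linear_sum rm linear0.
have [x|J2 [y [b [zE ba]]]] := Fe J I (fun j => p (z j)) a.
  under eq_bigr => j _ do rewrite -linearZ.
  by rewrite -linear_sum -mE; apply/ip; exists (m x).
have /choice[v vE] x := pS (y x).
have /choice[k kE] j : exists k, i k = z j - \sum_l (b l j : R^c) *: v l.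
  apply/ip; rewrite linearB linear_sum /= zE; apply/eqP; rewrite subr_eq0; apply/eqP.
  by apply: eq_bigr => l _; rewrite linearZ vE.
exists J, k, a; split=> // x; apply: iI; rewrite linear_sum mE.
under [RHS]eq_bigr => j _ do rewrite linearZ /= kE scalerBr scaler_sumr.
rewrite sumrB exchange_big /= [X in _ - X]big1 ?subr0 // => l _.
under eq_bigr => j _ do rewrite scalerA.
rewrite -scaler_suml -[RHS](scale0r (v l)); congr (_ *: _).
by rewrite -[RHS](ba l x).
Qed.

End EquationalCriterion.

Section FlatQuotient.
Variables (R Q : pzRingType) (iota : {rmorphism R -> Q}).
Hypothesis Qq : is_classical_quotient_ring iota.
Local Notation res := (restrict iota).
Local Notation Q_R := (restr_right iota : rmodType R).

Lemma fin_left_denominator (I : finType) (q : I -> Q) :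
  exists s t (a : I -> R), denom iota s t /\ forall i, q i = t * iota (a i).
Proof.
have [s [t [st H]]] := left_common_denominator Qq [seq q i | i <- enum I].
have /choice[a aE] i : exists a, q i = t * iota a.
  by apply: H; apply: map_f; rewrite mem_enum.
by exists s, t, a.
Qed.

Lemma fin_right_denominator (I : finType) (q : I -> Q) :
  exists s t (a : I -> R), denom iota s t /\ forall i, q i = iota (a i) * t.
Proof.
have [s [t [st H]]] := right_common_denominator Qq [seq q i | i <- enum I].
have /choice[a aE] i : exists a, q i = iota a * t.
  by apply: H; apply: map_f; rewrite mem_enum.
by exists s, t, a.
Qed.

(** A relation in [Q], multiplied by a common left denominator, is a relation in
    [R]. *)
Lemma flat_quotient_ring : flat_mod Q_R.
Proof.
apply: eq_flat_flat => I K q r rq.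
have [s [t [a [st qE]]]] := fin_left_denominator (q : I -> Q).
exists unit, (fun=> t : Q_R), (fun _ i => a i); split=> [i|_ k].
  by rewrite (big_pred1 tt) ?qE //; case.
apply: (cq_inj Qq); rewrite rmorph0 rmorph_sum /=.
transitivity (iota s * ((\sum_i (r i k : R^c) *: q i) : Q_R) : Q).
  2: by rewrite rq mulr0.
rewrite mulr_sumr; apply: eq_bigr => i _.
by rewrite restr_rightE qE rmorphM !mulrA st.1 mul1r.
Qed.

Lemma scaler_rev (V : rmodType Q) (a b : Q) (v : V) :
  (a : Q^c) *: ((b : Q^c) *: v) = ((b * a : Q) : Q^c) *: v.
Proof. exact: scalerA. Qed.

Lemma loc_common_denominator (F : rmodType R) (I : finType) (x : I -> loc Qq F) :
  exists s t (y : I -> F),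
    denom iota s t /\ forall i, x i = (t : Q^c) *: (loc_map Qq F (y i) : loc Qq F).
Proof.
have /choice[y yE] i := loc_map_surj (x i).
have /choice[s sE] := yE; have /choice[t tE] := sE.
have [s0 [t0 [a [st0 taE]]]] := fin_right_denominator t.
exists s0, t0, (fun i => (a i : R^c) *: y i); split=> // i.
by rewrite loc_mapZ scalerA (tE i).2 taE.
Qed.

Lemma flat_torsion_free (F : rmodType R) s t (x : F) : flat_mod F -> denom iota s t ->
  (s : R^c) *: x = 0 -> x = 0.
Proof.
move=> /flat_eq_flat Fe st sx.
have [_|J [z [a [xE as0]]]] := Fe unit unit (fun=> x) (fun _ _ => s).
  by rewrite (big_pred1 tt) //; case.
rewrite (xE tt) big1 // => j _; suff -> : a j tt = 0 by rewrite scale0r.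
have := as0 j tt; rewrite (big_pred1 tt); last by case.
by move=> e; apply: (denom_regular Qq st).2; rewrite e mul0r.
Qed.

Lemma flat_loc_map_inj (F : rmodType R) : flat_mod F -> injective (loc_map Qq F).
Proof.
move=> Ff; apply: inj_of_ker => x /loc_map_ker [s [t [st]]].
by move=> sx; apply: (flat_torsion_free Ff st sx).
Qed.

(** Clearing denominators turns relations in the localisation into relations in
    [F], whose solution is then divided again, now with denominators on the left. *)
Lemma flat_loc (F : rmodType R) : flat_mod F -> flat_mod (res (loc Qq F)).
Proof.
move=> Ff; have Fe := flat_eq_flat Ff; apply: eq_flat_flat => I K x r rx.
have [s [t [y [st xE]]]] := loc_common_denominator (x : I -> loc Qq F).
have [s1 [t1 [r' [st1 r'E]]]] :=
  fin_right_denominator (fun ik : I * K => t * iota (r ik.1 ik.2)).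
have [k|J [z [a [yE ar]]]] := Fe I K y (fun i k => r' (i, k)).
  apply: (flat_loc_map_inj Ff); rewrite linear0 linear_sum.
  transitivity ((iota s1 : Q^c) *: ((\sum_i (r i k : R^c) *: x i) : loc Qq F)).
    rewrite scaler_sumr; apply: eq_bigr => i _.
    transitivity ((iota (r' (i, k)) : Q^c) *: (loc_map Qq F (y i) : loc Qq F)).
      exact: loc_mapZ.
    have -> : iota (r' (i, k)) = t * (iota (r i k) * iota s1).
      by rewrite mulrA (r'E (i, k)) -mulrA st1.2 mulr1.
    rewrite -scaler_rev -scaler_rev -xE; exact: erefl.
  by rewrite rx scaler0.
have [s2 [t2 [b [st2 bE]]]] := fin_left_denominator (fun ji : J * I => iota (a ji.1 ji.2) * t).
exists J, (fun j => (t2 : Q^c) *: (loc_map Qq F (z j) : loc Qq F)), (fun j i => b (j, i)).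
split=> [i|j k].
  rewrite xE yE linear_sum scaler_sumr; apply: eq_bigr => j _.
  transitivity ((t : Q^c) *: ((iota (a j i) : Q^c) *: (loc_map Qq F (z j) : loc Qq F))).
    exact: (congr1 (fun u : loc Qq F => (t : Q^c) *: u) (loc_mapZ Qq (a j i) (z j))).
  by rewrite scaler_rev (bE (j, i)) -scaler_rev; exact: erefl.
apply: (cq_inj Qq); rewrite rmorph0 rmorph_sum /=.
transitivity (iota s2 * iota (\sum_i a j i * r' (i, k)) * t1); last first.
  by rewrite ar rmorph0 mulr0 mul0r.
rewrite rmorph_sum mulr_sumr mulr_suml; apply: eq_bigr => i _.
rewrite !rmorphM -!mulrA -(r'E (i, k)) /= (mulrA (iota (a j i))) (bE (j, i)).
by rewrite !mulrA st2.1 mul1r.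
Qed.

End FlatQuotient.

(** * Enough injectives *)

Definition divisible_group (D : zmodType) :=
  forall (n : nat) (d : D), exists d', d' *+ n.+1 = d.

(** Writing [M = Z^(M) / L], it embeds into the quotient of the rational vector
    space on [M] by [L]. *)
Lemma embed_divisible_group (M : zmodType) :
  exists (D : zmodType) (e : {additive M -> D}), divisible_group D /\ injective e.
Proof.
pose F := free_mod rat M.
pose ev : free_mod int M -> zmodule M := linear_comb (id : M -> zmodule M).
pose G (v : F) := exists2 w : free_mod int M,
  forall x, fcoord x v = (fcoord x w)%:~R & ev w = 0.
have evB u v : ev (u - v) = ev u - ev v by rewrite /ev linearB.
have evb x : ev (basis int x) = x by rewrite /ev linear_comb_basis.
have G0 : G 0 by exists 0; [move=> x; rewrite !fcoord0 | exact: linear0].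
have GD u v : G u -> G v -> G (u + v).
  move=> [a ua a0] [b vb b0]; exists (a + b); last first.
    by rewrite /ev linearD -/(ev a) -/(ev b) a0 b0 addr0.
  by move=> x; rewrite !fcoordD ua vb rmorphD.
have GN u : G u -> G (- u).
  move=> [a ua a0]; exists (- a); last by rewrite /ev linearN -/(ev a) a0 oppr0.
  by move=> x; rewrite !fcoordN ua rmorphN.
have [D [p [pS p0]]] := additive_quotient G0 GD GN.
have eA : zmod_morphism (fun x : M => p (basis rat x)).
  move=> x y; rewrite -raddfB; apply/subr0_eq; rewrite -raddfB; apply/p0.
  exists (basis int (x - y) - (basis int x - basis int y)) => [z|].
    by rewrite !(fcoordD, fcoordN) !fcoord_basis !(rmorphD, rmorphN) /= !rmorph_nat.
  by rewrite !evB !evb; exact: (subrr (x - y)).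
exists D, (to_additive eA); split=> [n d|x y exy].
  have [v <-] := pS d; exists (p (n.+1%:R^-1 *: v)); rewrite -raddfMn; congr (p _).
  by rewrite -scaler_nat scalerA divff ?scale1r // pnatr_eq0.
have /p0 [w we ew0] : p (basis rat (x - y)) = 0.
  have := raddfB (to_additive eA) x y; rewrite exy subrr; exact.
apply/subr0_eq; rewrite -ew0 -[LHS]evb; congr ev.
apply: fcoord_inj => z; apply: (@intr_inj rat).
by rewrite -we !fcoord_basis rmorph_nat.
Qed.

Lemma pair_intmul (N D : zmodType) (a : N) (b : D) (k : int) :
  (a, b) *~ k = (a *~ k, b *~ k).
Proof.
rewrite [LHS]surjective_pairing; congr pair.
  exact: (raddfMz (fst : {additive (N * D)%type -> N})).
exact: (raddfMz (snd : {additive (N * D)%type -> D})).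
Qed.

Section DivisibleExtension.
Variables (M N D : zmodType) (i : {additive M -> N}) (f : {additive M -> D}).
Hypotheses (Dd : divisible_group D) (iI : injective i).

(** Graphs of additive maps from subgroups of [N] to [D]. *)
Definition partial_map (G : set (N * D)) :=
  [/\ G 0, forall u v, G u -> G v -> G (u - v) & forall d, G (0, d) -> d = 0].

Lemma partial_mapZ G u (k : int) : partial_map G -> G u -> G (u *~ k).
Proof.
move=> [G0 GB _] Gu.
have GN v : G v -> G (- v) by move=> Gv; rewrite -sub0r; apply: GB.
have Gn n : G (u *+ n).
  elim: n => [|n IH]; first by rewrite mulr0n.
  by rewrite mulrS -[u *+ n]opprK; apply: (GB) => //; apply: GN.
by case: k => n; [exact: Gn | apply: GN; exact: (Gn n.+1)].
Qed.

(** If [n k] is the least positive multiple of [n] in the domain, [d] is a [k]-th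
    part of its value; if there is none, the value at [n] is arbitrary. *)
Lemma partial_map_extend G n : partial_map G ->
  exists G' d, [/\ partial_map G', G `<=` G' & G' (n, d)].
Proof.
move=> Gp; have [G0 GB Gf] := Gp.
have GD u v : G u -> G v -> G (u + v).
  by move=> Gu Gv; rewrite -[v]opprK; apply: (GB) => //; rewrite -sub0r; apply: (GB).
suff [d dE] : exists d, forall k y, G (n *~ k, y) -> y = d *~ k.
  exists [set w | exists2 g, G g & exists k, w = g + (n, d) *~ k], d; split.
  - split; first by exists 0 => //; exists 0; rewrite mulr0z addr0.
      move=> _ _ [g Gg [k ->]] [h Gh [l ->]]; exists (g - h); first exact: GB.
      by exists (k - l); rewrite mulrzBr opprD addrACA.
    move=> y [[a b] Gg [k /= e]].
    have [ea eb] : a = n *~ (- k) /\ y = b + d *~ k.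
      move: e; rewrite pair_intmul => -[/esym/eqP]; rewrite addr_eq0 => /eqP -> ->.
      by rewrite mulrNz.
    by rewrite eb (dE (- k) b); [rewrite mulrNz addNr | rewrite -ea].
  - by move=> g Gg; exists g => //; exists 0; rewrite mulr0z addr0.
  - by exists 0 => //; exists 1; rewrite mulr1z add0r.
pose dom k := `[< exists y, G (n *+ k.+1, y) >].
have [ek|none] := pselect (exists k, dom k).
  have [k /asboolP[y0 Gy0] kmin] := ex_minnP ek.
  have [d dy0] := Dd k y0; exists d => j y Gy.
  pose q := (j %/ k.+1)%Z; pose r := `|(j %% k.+1)%Z|%N.
  have rE : (r : int) = (j %% k.+1)%Z by rewrite /r gez0_abs // modz_ge0.
  have jE : j = q * (k.+1 : int) + r by rewrite rE -divz_eq.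
  have Gr : G (n *+ r, y - y0 *~ q).
    have -> : (n *+ r, y - y0 *~ q) = (n *~ j, y) - (n *+ k.+1, y0) *~ q.
      rewrite !pair_intmul; congr pair; rewrite /= jE.
      transitivity (n *~ (q * k.+1 + r) - n *~ (k.+1 : int) *~ q); last by [].
      by rewrite -mulrzA mulrC -mulrzBr addrC addKr.
    by apply: (GB) => //; apply: partial_mapZ.
  case r0 : r => [|r'].
    move: Gr; rewrite r0 mulr0n => /Gf/eqP; rewrite subr_eq0 => /eqP ->.
    by rewrite jE r0 addr0 -dy0 pmulrn -mulrzA mulrC.
  have /kmin : dom r'.
    by apply/asboolP; eexists; rewrite -r0; exact: Gr.
  rewrite leqNgt -ltnS -r0 -ltz_nat rE.
  by rewrite ltz_pmod.
exists 0 => j y Gy; rewrite mul0rz.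
case: j Gy => [[|j]|j] Gy.
- by apply: Gf; rewrite mulr0z in Gy.
- by case: none; exists j; apply/asboolP; exists y.
- case: none; exists j; apply/asboolP; exists (- y).
  have := partial_mapZ (-1) Gp Gy; rewrite pair_intmul !mulrN1z.
  by have -> : - (n *~ Negz j) = n *+ j.+1 by exact: opprK.
Qed.

Lemma divisible_group_extend : exists g : {additive N -> D}, forall x, g (i x) = f x.
Proof.
pose G0 : set (N * D) := [set w | exists x, w = (i x, f x)].
(* adjoining the graph of f keeps the empty chain admissible *)
pose P (G : set (N * D)) := partial_map (G0 `|` G).
have P0 : P set0.
  rewrite /P setU0; split.
  - by exists 0; rewrite !raddf0.
  - by move=> _ _ [x ->] [y ->]; exists (x - y); rewrite !raddfB.
  - move=> d [x [/esym ix ->]].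
    by have -> : x = 0 by [apply: iI; rewrite ix raddf0]; rewrite raddf0.
have [F FP Ft|A [PA Amax]] := @Zorn_bigcup _ P.
  have dir u v : (G0 `|` \bigcup_(X in F) X) u -> (G0 `|` \bigcup_(X in F) X) v ->
      exists X, [/\ P X, X `<=` \bigcup_(X in F) X, (G0 `|` X) u & (G0 `|` X) v].
    have sub X : F X -> X `<=` \bigcup_(X in F) X by move=> FX w Xw; exists X.
    move=> [G0u|[X FX Xu]] [G0v|[Y FY Yv]].
    - by exists set0; split=> //; left.
    - by exists Y; split; [exact: FP | exact: sub | left | right].
    - by exists X; split; [exact: FP | exact: sub | right | left].
    - have [XY|YX] := Ft _ _ FX FY.
        by exists Y; split; [exact: FP | exact: sub | right; apply: XY | right].
      by exists X; split; [exact: FP | exact: sub | right | right; apply: YX].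
  split.
  - by left; exists 0; rewrite !raddf0.
  - move=> u v Uu Uv; have [X [[_ XB _] sX Xu Xv]] := dir _ _ Uu Uv.
    by have [?|/sX ?] := XB _ _ Xu Xv; [left | right].
  - by move=> d Ud; have [X [[_ _ Xf] _ Xd _]] := dir _ _ Ud Ud; apply: Xf.
have [G0' GB Gf] := PA; set G := (G0 `|` A)%classic in G0' GB Gf.
have /choice[g gE] n : exists d, G (n, d).
  have [//|nn] := pselect (exists d, G (n, d)).
  have [G' [d [G'p GG' G'n]]] := partial_map_extend n PA.
  have GU : (G0 `|` G')%classic = G'.
    by apply/seteqP; split=> [w [G0w|//]|w]; [apply: GG'; left | right].
  case: (Amax G'); last by rewrite /P GU.
  split=> [w Aw|G'A]; first by apply: GG'; right.
  by case: nn; exists d; right; apply: G'A.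
have Gu n d : G (n, d) -> d = g n.
  move=> Gnd; apply/subr0_eq/Gf; have := GB _ _ Gnd (gE n).
  by congr G; congr pair; rewrite /= subrr.
have gA : zmod_morphism g by move=> x y; rewrite -(Gu _ _ (GB _ _ (gE x) (gE y))).
by exists (to_additive gA) => x; rewrite /= -(Gu (i x) (f x)) //; left; exists x.
Qed.

End DivisibleExtension.

Section Coinduced.
Variables (A : pzRingType) (D : zmodType).

Definition additive_fun (phi : A -> D) := forall a b, phi (a + b) = phi a + phi b.

Definition additive_funs : submodule (zmodule (A -> D)).
Proof.
exists additive_fun; first by move=> a b; exact: esym (addr0 0).
move=> c u v uD vD a b.
have cE w x : (c *: (w : zmodule (A -> D))) x = w x *~ c.
  have evA : zmod_morphism (fun w : A -> D => w x) by [].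
  exact: (raddfMz (to_additive evA) c w).
have sE x : (c *: (u : zmodule (A -> D)) + v) x = u x *~ c + v x by rewrite -cE.
by rewrite !sE uD vD mulrzDl addrACA.
Defined.

(** The coinduced module [Hom_Z(A, D)], where [a] acts by [phi |-> phi (_ * a)]. *)
Definition coinduced : Type := subm additive_funs.
HB.instance Definition _ := GRing.Zmodule.copy coinduced (subm additive_funs).

Definition cval (x : coinduced) : A -> D := subm_incl additive_funs x.

Lemma cvalD x y a : cval (x + y) a = cval x a + cval y a.
Proof. by rewrite /cval linearD. Qed.

Lemma cval_add x a b : cval x (a + b) = cval x a + cval x b.
Proof. exact: (submP (x : subm additive_funs)). Qed.

Lemma cval_inj x y : (forall a, cval x a = cval y a) -> x = y.
Proof. by move=> exy; apply: (@subm_inj _ _ additive_funs); apply/funext. Qed.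

Lemma cval_exists (phi : A -> D) : additive_fun phi -> exists x, forall a, cval x a = phi a.
Proof.
by move=> /(@subm_exists _ _ additive_funs)[x xE]; exists x => a; rewrite /cval xE.
Qed.

Fact cscale_sig : {s : A -> coinduced -> coinduced |
  forall a x b, cval (s a x) b = cval x (b * a)}.
Proof.
apply/cid; suff /choice[s sE] a : exists s : coinduced -> coinduced,
    forall x b, cval (s x) b = cval x (b * a) by exists s.
suff /choice[s sE] x : exists y, forall b, cval y b = cval x (b * a) by exists s.
by apply: cval_exists => b c; rewrite mulrDl cval_add.
Qed.
Definition cscale := sval cscale_sig.
Lemma cscaleE a x b : cval (cscale a x) b = cval x (b * a).
Proof. exact: (svalP cscale_sig). Qed.

Fact cscaleA a b x : cscale a (cscale b x) = cscale (a * b) x.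
Proof. by apply: cval_inj => c; rewrite !cscaleE mulrA. Qed.
Fact cscale1 : left_id 1 cscale.
Proof. by move=> x; apply: cval_inj => c; rewrite cscaleE mulr1. Qed.
Fact cscaleDr : right_distributive cscale +%R.
Proof. by move=> a x y; apply: cval_inj => c; rewrite !(cscaleE, cvalD). Qed.
Fact cscaleDl x : {morph cscale^~ x : a b / a + b}.
Proof. by move=> a b; apply: cval_inj => c; rewrite !(cscaleE, cvalD) mulrDr cval_add. Qed.
HB.instance Definition _ := GRing.Zmodule_isLmodule.Build A coinduced
  cscaleA cscale1 cscaleDr cscaleDl.

Lemma cvalZ a (x : coinduced) b : cval (a *: x) b = cval x (b * a).
Proof. exact: cscaleE. Qed.

(** [Hom_A(M, Hom_Z(A, D)) = Hom_Z(M, D)], by evaluation at [1]. *)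
Lemma injective_coinduced : divisible_group D -> injective_mod coinduced.
Proof.
move=> Dd M N i f iI.
have fA : zmod_morphism (fun m => cval (f m) 1).
  move=> x y; apply/eqP; rewrite eq_sym subr_eq -cvalD -linearD subrK //.
have [g gE] := divisible_group_extend (i := i) (to_additive fA) Dd iI.
have /choice[h hE] n : exists x, forall a, cval x a = g (a *: n).
  by apply: cval_exists => a b; rewrite scalerDl raddfD.
have hL : linear h.
  move=> a u v; apply: cval_inj => b.
  by rewrite cvalD cvalZ !hE scalerDr scalerA raddfD.
exists (to_linear hL) => m; apply: cval_inj => a.
by rewrite hE -linearZ gE /= linearZ cvalZ mul1r.
Qed.

End Coinduced.

Lemma enough_injectives (A : pzRingType) (M : lmodType A) :
  exists (E : lmodType A) (e : {linear M -> E}), injective_mod E /\ injective e.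
Proof.
have [D [e [Dd eI]]] := embed_divisible_group M.
have /choice[h hE] m : exists x : coinduced A D, forall a, cval x a = e (a *: m).
  by apply: cval_exists => a b; rewrite scalerDl raddfD.
have hL : linear h.
  move=> a u v; apply: cval_inj => b.
  by rewrite cvalD cvalZ !hE scalerDr scalerA raddfD.
exists (coinduced A D), (to_linear hL); split; first exact: injective_coinduced.
by move=> x y /= hxy; apply: eI; rewrite -[x]scale1r -[y]scale1r -!hE hxy.
Qed.

(** * Divisible modules are orthogonal to modules of projective dimension one *)

Section DivisibleChain.
Variables (R Q : pzRingType) (iota : {rmorphism R -> Q}).
Hypothesis Qq : is_classical_quotient_ring iota.
Variable M : rmodType R.
Hypothesis Md : divisible M.

(** [t n] is the inverse of a regular element and [x n] the value to be given to
    [t n] by an extension of [r |-> m r]. *)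
Lemma divisible_chain (m : M) (l : nat -> seq Q) :
  exists (t : nat -> Q) (x : nat -> M), [/\ t 0%N = 1, x 0%N = m,
    forall n, exists s, denom iota s (t n),
    forall n q, q \in l n -> exists a, q = t n.+1 * iota a &
    forall n, exists r, t n = t n.+1 * iota r /\ (r : R^c) *: x n.+1 = x n].
Proof.
pose ok (c : Q * M) := exists s, denom iota s c.1.
have /choice[next nextE] (nc : nat * (Q * M)) : exists c : Q * M, ok nc.2 ->
    [/\ ok c, forall q, q \in l nc.1 -> exists a, q = c.1 * iota a &
     exists r, nc.2.1 = c.1 * iota r /\ (r : R^c) *: c.2 = nc.2.2].
  case: nc => n [t x] /=.
  have [[s st]|no] := pselect (ok (t, x)); last by exists (t, x).
  have [s' [t' [st' H]]] := left_common_denominator Qq (t :: l n).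
  have [|r tr] := H t; first by rewrite inE eqxx.
  have [|x' rx] := Md (s := r) _ x.
    apply: (denom_regular Qq (t := iota s * t')).
    have ir : iota r = iota s' * t by rewrite tr mulrA st'.1 mul1r.
    split; rewrite ir; first by rewrite mulrA -(mulrA (iota s')) st.2 mulr1 st'.1.
    by rewrite mulrA -(mulrA (iota s)) st'.2 mulr1 st.1.
  exists (t', x') => _; split; [by exists s' | | by exists r].
  by move=> q ql; apply: H; rewrite inE ql orbT.
pose c := fix c n : Q * M := if n is n'.+1 then next (n', c n') else (1, m).
have cok n : ok (c n).
  elim: n => [|n IH]; first by exists 1; exact: denom1.
  by have [] := nextE (n, c n) IH.
exists (fun n => (c n).1), (fun n => (c n).2); split=> //.
- by move=> n q ql; have [_ H _] := nextE (n, c n) (cok n); apply: H.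
- by move=> n; have [_ _] := nextE (n, c n) (cok n).
Qed.

(** Over a countable set of denominators, a map [R -> M] extends step by step,
    by divisibility, along a chain of cyclic free submodules [t n R] of [Q]. *)
Lemma divisible_extend (m : M) (l : nat -> seq Q) :
  exists (U : submodule (restr_right iota : rmodType R)) (phi : Q -> M),
  [/\ forall n q, q \in l n -> U q,
      forall u v, U u -> U v -> phi (u + v) = phi u + phi v,
      forall u (r : R), U u -> phi (u * iota r) = (r : R^c) *: phi u &
      forall r, U (iota r) /\ phi (iota r) = (r : R^c) *: m].
Proof.
have [t [x [t0 x0 tden tl step]]] := divisible_chain m l.
have up n k : exists r, t n = t (k + n)%N * iota r /\ (r : R^c) *: x (k + n)%N = x n.
  elim: k => [|k [r [tr xr]]]; first by exists 1; rewrite rmorph1 mulr1 scale1r.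
  have [r' [tr' xr']] := step (k + n)%N.
  exists (r' * r); rewrite addSn tr tr' rmorphM mulrA; split=> //.
  by rewrite -xr -xr' scalerA.
pose V q y := exists n a, q = t n * iota a /\ y = (a : R^c) *: x n.
have Vup n k a : exists b, t n * iota a = t (k + n)%N * iota b /\
    (a : R^c) *: x n = (b : R^c) *: x (k + n)%N.
  have [r [-> <-]] := up n k; exists (r * a); rewrite rmorphM mulrA; split=> //.
  by rewrite scalerA.
have Vtwo q y q' y' : V q y -> V q' y' -> exists n a b,
    [/\ q = t n * iota a, y = (a : R^c) *: x n, q' = t n * iota b & y' = (b : R^c) *: x n].
  move=> [n [a [-> ->]]] [n' [a' [-> ->]]].
  have [b [-> ->]] := Vup n n' a; have [b' [-> ->]] := Vup n' n a'.
  by rewrite [(n + n')%N]addnC; exists (n' + n)%N, b, b'.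
have Vfun q y y' : V q y -> V q y' -> y = y'.
  move=> Vy Vy'; have [n [a [b [-> -> e ->]]]] := Vtwo _ _ _ _ Vy Vy'.
  have [s st] := tden n; congr (_ *: _); apply: (cq_inj Qq).
  by rewrite -[LHS]mul1r -[RHS]mul1r -st.1 -!mulrA e.
have VD q y q' y' : V q y -> V q' y' -> V (q + q') (y + y').
  move=> Vy Vy'; have [n [a [b [-> -> -> ->]]]] := Vtwo _ _ _ _ Vy Vy'.
  by exists n, (a + b); rewrite rmorphD mulrDr scalerDl.
have VZ q y (r : R) : V q y -> V (q * iota r) ((r : R^c) *: y).
  move=> [n [a [-> ->]]]; exists n, (a * r); rewrite rmorphM mulrA; split=> //.
  by rewrite scalerA.
have V1 r : V (iota r) ((r : R^c) *: m).
  by exists 0%N, r; rewrite t0 mul1r x0.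
have U0 : exists y, V 0 y by exists ((0 : R^c) *: m); rewrite -(rmorph0 iota); apply: V1.
have UL (r : R^c) (u v : restr_right iota) : (exists y, V u y) -> (exists y, V v y) ->
    exists y, V (r *: u + v) y.
  by move=> [y Vy] [z Vz]; exists ((r : R^c) *: y + z); apply/VD/Vz/VZ.
have /choice[phi phiE] q : exists y, (exists z, V q z) -> V q y.
  by have [[z Vz]|no] := pselect (exists z, V q z); [exists z | exists 0].
have phiV q y : V q y -> phi q = y.
  by move=> Vy; apply: (Vfun q) => //; apply: phiE; exists y.
exists (Submodule U0 UL), phi; split=> /=.
- move=> n q /tl [a qa]; exists ((a : R^c) *: x n.+1); exists n.+1, a; split=> //.
- by move=> u v Uu Uv; apply: phiV; apply: VD; apply: phiE.
- by move=> u r Uu; apply: phiV; apply: VZ; apply: phiE.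
- by move=> r; split; [exists ((r : R^c) *: m); apply: V1 | apply: phiV; apply: V1].
Qed.

Section Filtration.
Variables (X : choiceType) (K : rmodType R).
Variables (j : {linear K -> free_mod R^c X}) (u : {linear K -> free_mod R^c K}).
Variable theta : K -> X -> Q.
Hypothesis u_section : forall k, linear_comb id (u k) = k.
Hypothesis theta_fin : forall x, fin_supp (fun y => theta y x).
(* the coordinates of u, as functions on K, extend along j to Q-valued ones *)
Hypothesis thetaE : forall k y s, uniq s -> supported s (fun x => fcoord x (j k)) ->
  \sum_(x <- s) theta y x * iota (rcoord x (j k)) = iota (rcoord y (u k)).
Variable f : {linear K -> M}.

(** If [C] is closed and [k] in [K] is supported in [C], so are all the [y] that occur
    in the dual basis expansion of [k]. *)
Definition theta_closed (C : X -> Prop) := forall x y x', C x ->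
  theta y x != 0 -> fcoord x' (j y) != 0 -> C x'.

(** An element interacts with finitely many others, so the hull of a point is a
    countable union of finite sets. *)
Lemma theta_hull (x0 : X) : exists L : nat -> seq X,
  x0 \in L 0%N /\ theta_closed (fun x => exists n, x \in L n).
Proof.
have /choice[sj sjE] y := fcoord_supp (j y).
have /choice[st stE] := theta_fin.
pose next x := flatten [seq sj y | y <- st x].
pose L := fix L n := if n is n'.+1 then flatten [seq next x | x <- L n'] else [:: x0].
exists L; split=> [|x y x' [n xn] xy yx']; first by rewrite inE eqxx.
exists n.+1; apply/flattenP; exists (next x); first exact: map_f.
apply/flattenP; exists (sj y); last first.
  by apply: contraR yx' => /sjE ->; rewrite eqxx.
by apply: map_f; apply: contraR xy => /stE ->; rewrite eqxx.
Qed.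

(** [G] is the graph of a map from a closed set [C] of basis elements to [M] that
    prolongs [f] from the part of [K] supported in [C].  A graph, rather than a map
    with a domain, makes unions of chains immediate. *)
Definition partial_extension (G : set (X * M)) :=
  [/\ forall x m m', G (x, m) -> G (x, m') -> m = m',
      theta_closed (fun x => exists m, G (x, m)) &
      forall k h, (forall x, fcoord x (j k) != 0 -> G (x, h x)) ->
        f k = linear_comb h (j k)].

Lemma partial_extension0 : partial_extension set0.
Proof.
split=> // k h kh.
have jk x : fcoord x (j k) = 0.
  by have [//|/kh] := eqVneq (fcoord x (j k)) 0.
have -> : j k = 0 by apply: fcoord_inj => x; rewrite jk fcoord0.
have uk : u k = 0.
  apply: fcoord_inj => y; rewrite fcoord0; apply: (cq_inj Qq); rewrite rmorph0.
  by rewrite -[LHS](@thetaE k y [::]) ?big_nil.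
by rewrite -[k in LHS]u_section uk !linear0.
Qed.

Lemma partial_extension_chain (F : set (set (X * M))) :
  F `<=` partial_extension -> total_on F subset ->
  partial_extension (\bigcup_(G in F) G).
Proof.
move=> FP Ft; split.
- move=> x m m' [G FG Gm] [H FH Hm].
  have [GH|HG] := Ft _ _ FG FH.
    by have [fun_ _ _] := FP _ FH; apply: fun_ (GH _ Gm) Hm.
  by have [fun_ _ _] := FP _ FG; apply: fun_ Gm (HG _ Hm).
- move=> x y x' [m [G FG Gm]] xy yx'.
  have [_ cl _] := FP _ FG; have [|m' Gm'] := cl x y x' _ xy yx'; first by exists m.
  by exists m', G.
move=> k h kh; have [s sk] := fcoord_supp (j k).
pose s' := [seq x <- s | fcoord x (j k) != 0].
have [s0|[G FG sG]] : s' = [::] \/ exists2 G, F G & forall x, x \in s' -> G (x, h x).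
  have : forall x, x \in s' -> (\bigcup_(G in F) G) (x, h x).
    by move=> x; rewrite mem_filter => /andP[/kh].
  elim: s' => [|x r IH] H; [by left | right].
  have [|G FG Gx] := H x; first by rewrite inE eqxx.
  have [|r0|[G' FG' G'r]] := IH.
  - by move=> z zr; apply: H; rewrite inE zr orbT.
  - by exists G => // z; rewrite r0 inE => /eqP ->.
  have [GG'|G'G] := Ft _ _ FG FG'.
    by exists G' => // z; rewrite inE => /orP[/eqP ->|/G'r //]; apply: GG'.
  by exists G => // z; rewrite inE => /orP[/eqP -> //|/G'r]; apply: G'G.
all: have jk0 x : fcoord x (j k) != 0 -> x \in s'.
- by move=> x0; rewrite mem_filter x0; apply: contraR x0 => /sk ->; rewrite eqxx.
- have [_ _ ex] := partial_extension0; apply: ex => x /jk0.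
  by rewrite s0.
- by move=> x0; rewrite mem_filter x0; apply: contraR x0 => /sk ->; rewrite eqxx.
- by have [_ _ ex] := FP _ FG; apply: ex => x /jk0 /sG.
Qed.

(** One step: the countable hull [L] of a new point is added to the domain [C].
    After subtracting the map already built, [f] vanishes on those [y] with
    [theta y x <> 0] for some [x] in [C], since they are supported in [C], and on each remaining [y] it is extended to the submodule of [Q]
    containing the countably many coefficients [theta y x], [x] in [L]. *)
Lemma partial_extension_step (G : set (X * M)) (x0 : X) : partial_extension G ->
  exists G' m, [/\ partial_extension G', G `<=` G' & G' (x0, m)].
Proof.
move=> [Gfun Gcl Gex].
pose C x := exists m, G (x, m).
have [L [Lx0 Lcl]] := theta_hull x0.
pose C' x := C x \/ exists n, x \in L n.
have /choice[h0 h0E] x : exists m, C x -> G (x, m).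
  by have [[m Gm]|no] := pselect (C x); [exists m | exists 0].
have [fh fhE] : exists fh : {linear K -> M}, forall k, fh k = f k - linear_comb h0 (j k).
  by exists (f \- (linear_comb h0 \o j) : {linear _ -> _}).
pose Y y := exists2 x, C x & theta y x != 0.
have fhY y : Y y -> fh y = 0.
  move=> [x Cx xy]; rewrite fhE (Gex y h0) ?subrr // => x' x'y.
  exact: h0E (Gcl x y x' Cx xy x'y).
have /choice[U UE] y := divisible_extend (fh y) (fun n => [seq theta y x | x <- L n]).
have /choice[phi phiE] := UE.
pose g x := fsum (fun y => if `[< Y y >] then 0 else phi y (theta y x)).
have phi0 y : phi y 0 = 0.
  have [_ D _ one] := phiE y; apply: (addrI (phi y 0)); rewrite -D ?addr0 //; exact: sm_0.
have gC x : C x -> g x = 0.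
  move=> Cx; rewrite /g (@fsumE _ _ _ [::]) ?big_nil // => y _.
  case: asboolP => // nY.
  have -> : theta y x = 0 by apply: contra_notP nY => /eqP xy; exists x.
  exact: phi0.
have gfin x s : uniq s -> supported s (fun y => theta y x) ->
    g x = \sum_(y <- s) if `[< Y y >] then 0 else phi y (theta y x).
  by move=> us sx; apply: fsumE => // y /sx ->; rewrite phi0 if_same.
exists [set w | C' w.1 /\ w.2 = h0 w.1 + g w.1], (h0 x0 + g x0); split.
- split.
  + by move=> x m m' [_ /= ->] [_ /= ->].
  + move=> x y x' [m [Cx _]] xy yx'; exists (h0 x' + g x'); split=> //=.
    case: Cx => [Cx|[n xn]]; first by left; apply: Gcl xy yx'.
    by right; apply: Lcl xy yx'; exists n.
  move=> k h kh; have [s us sk] := fin_suppP (fcoord_supp (j k)).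
  suff fhk : fh k = linear_comb g (j k).
    have -> : f k = fh k + linear_comb h0 (j k) by rewrite fhE subrK.
    rewrite fhk !(linear_comb_seq _ us sk) -big_split /=; apply: eq_bigr => x _.
    have [->|/kh[_ /= ->]] := eqVneq (fcoord x (j k)) 0; first by rewrite !scale0r addr0.
    by rewrite scalerDr addrC.
  pose s' := [seq x <- s | fcoord x (j k) != 0].
  have us' : uniq s' by rewrite filter_uniq.
  have sk' : supported s' (fun x => fcoord x (j k)).
    move=> x; rewrite mem_filter negb_and negbK => /orP[/eqP //|]; exact: sk.
  have sC x : x \in s' -> C' x by rewrite mem_filter => /andP[/kh[]].
  have /choice[tx txE] := theta_fin; have [v vk] := fcoord_supp (u k).
  pose t := undup (v ++ flatten [seq tx x | x <- s']).
  have ut : uniq t by apply: undup_uniq.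
  have tsupp x : x \in s' -> supported t (fun y => theta y x).
    move=> xs y; rewrite mem_undup mem_cat negb_or => /andP[_ yt]; apply: txE.
    by apply: contra yt => yt; apply/flattenP; exists (tx x) => //; apply: map_f.
  have tk : supported t (fun y => fcoord y (u k)).
    by move=> y; rewrite mem_undup mem_cat negb_or => /andP[/vk].
  rewrite (linear_comb_seq _ us' sk') big_seq.
  under eq_bigr => x xs do rewrite (gfin x t ut (tsupp x xs)) scaler_sumr.
  rewrite -big_seq exchange_big /=.
  have -> : fh k = \sum_(y <- t) (rcoord y (u k) : R^c) *: fh y.
    rewrite -{1}(u_section k) (linear_comb_seq _ ut tk) linear_sum.
    by apply: eq_bigr => y _; rewrite linearZ.
  apply: eq_bigr => y _.
  case: asboolP => [Yy|nY].
    by rewrite big1 => [|x _]; rewrite ?scaler0 //; rewrite fhY // scaler0.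
  have [Ul UD UZ U1] := phiE y.
  have Ux x : x \in s' -> U y (theta y x).
    move=> /sC [Cx|[n xn]]; last by apply: (Ul n); apply: map_f.
    have -> : theta y x = 0 by apply: contra_notP nY => /eqP xy; exists x.
    exact: sm_0.
  have UZ' q (r : R) : U y q -> U y (q * iota r) by exact: (@sm_Z _ _ (U y) r q).
  have [_ <-] := U1 (rcoord y (u k)); rewrite -(thetaE y us' sk').
  (* phi y is linear on U y only, whence the induction *)
  elim: (s') Ux => [|x r IH] Ur; first by rewrite !big_nil phi0.
  have Urr z : z \in r -> U y (theta y z) by move=> zr; apply: Ur; rewrite inE zr orbT.
  have Uxx : U y (theta y x) by apply: Ur; rewrite inE eqxx.
  rewrite !big_cons UD ?UZ -?IH //; first exact: UZ'.
  rewrite big_seq; elim/big_ind: _ => [|a b|z /Urr]; last exact: UZ'.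
    exact: (@sm_0 _ _ (U y)).
  exact: (@sm_D _ _ (U y) a b).
- move=> [x m] Gm; have Cx : C x by exists m.
  by split; [left | rewrite /= gC // addr0; apply: Gfun Gm _; apply: h0E].
- by split=> //; right; exists 0%N.
Qed.

Lemma extension_exists : exists g : {linear free_mod R^c X -> M}, forall k, g (j k) = f k.
Proof.
have [F FP Ft|G [Gp Gmax]] := @Zorn_bigcup _ partial_extension.
  exact: partial_extension_chain.
have /choice[h hE] x : exists m, G (x, m).
  have [//|no] := pselect (exists m, G (x, m)).
  have [G' [m [G'p GG' G'm]]] := partial_extension_step x Gp.
  by case: (Gmax G'); [split=> // G'G; case: no; exists m; apply: G'G | exact: G'p].
by exists (linear_comb h) => k; have [_ _ ex] := Gp; rewrite -ex.
Qed.

End Filtration.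

(** [theta y x] is the coordinate at [y] of the image of the basis element [x] under
    [P (x) Q -> K (x) Q -> Q^(K)], a retraction followed by the localised [u]. *)
Lemma divisible_Ext1_zero (B : rmodType R) :
  right_Fdim_zero Q -> proj_dim_le 1 B -> Ext1_zero B M.
Proof.
move=> Fd B1; pose P := free_mod R^c B; pose p : {linear P -> B} := linear_comb id.
pose K := subm (kernel_sm p); pose j : {linear K -> P} := subm_incl (kernel_sm p).
have Pp : projective_mod P by exact: projective_free.
have jI : injective j by exact: subm_inj.
have jp : exact_at j p by exact: kernel_exact.
have pS : surj p by exact: free_cover.
have Kp : projective_mod K := projective_kernel B1 Pp jI jp pS.
apply: (Ext1_zero_of_extend (@projective_Ext1_zero _ _ M Pp) jp pS) => f.
have [u uE] := Kp _ _ (linear_comb id) idfun (@free_cover _ K).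
have [J [JE /(_ jI) JI]] := loc_functor Qq j.
have [r rE] := split_of_Fdim_zero Fd (projective_loc Kp) (projective_loc Pp) JI.
(* bas is the inclusion of R^(K) in Q^(K) *)
pose bas : {linear free_mod R^c K -> restrict iota (free_mod Q^c K)} :=
  linear_comb (fun y => basis Q^c y : restrict iota (free_mod Q^c K)).
have basE y w : rcoord y (bas w) = iota (rcoord y w).
  have [s us sw] := fin_suppP (fcoord_supp w).
  rewrite /bas (linear_comb_seq _ us sw) [LHS]fcoord_sum.
  under eq_bigr => x _ do rewrite restrict_scaleE -/(rcoord _ _) rcoordZ rcoord_basis.
  have [ys|ys] := boolP (y \in s); last first.
    rewrite [rcoord y w]sw // rmorph0 big_seq big1 // => x xs.
    by case: eqP => [e|]; [rewrite e xs in ys | rewrite mul0r].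
  rewrite (bigD1_seq y) //= eqxx mul1r big1 ?addr0 // => x /negbTE.
  by rewrite eq_sym => ->; rewrite mul0r.
have [b bE] := loc_extend Qq (bas \o u : {linear _ -> _}).
pose Th (x : P) : free_mod Q^c K := b (r (loc_map Qq P x)).
have ThD : {morph Th : x y / x + y} by move=> x y; rewrite /Th !linearD.
have ThZ (a : R) x : Th ((a : R^c) *: x) = (iota a : Q^c) *: Th x.
  by rewrite /Th loc_mapZ !linearZ.
have Thj k : Th (j k) = bas (u k) by rewrite /Th -JE rE bE.
apply: (@extension_exists _ _ j u (fun y x => rcoord y (Th (basis R^c x)))).
- by move=> k; rewrite uE.
- by move=> x; exact: (@fcoord_supp Q^c K (Th (basis R^c x))).
move=> k y s us sk; rewrite -basE -Thj.
transitivity (rcoord y (\sum_(x <- s) Th ((fcoord x (j k) : R^c) *: basis R^c x))).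
  rewrite [RHS]fcoord_sum; apply: eq_bigr => x _.
  by rewrite ThZ -/(rcoord _ _) rcoordZ.
have Th0 : Th 0 = 0 by rewrite /Th !linear0.
rewrite -(big_morph Th ThD Th0); congr (rcoord y (Th _)).
rewrite -[LHS](linear_comb_seq (@basis R^c B) us sk).
apply: (@free_ext _ _ _ (linear_comb (@basis R^c B)) idfun) => x.
by rewrite linear_comb_basis.
Qed.

End DivisibleChain.

(** * The equivalences *)

Section WeakDimension.
Variable R : pzRingType.

Lemma flat_zero_mod : flat_mod (zero_mod R^c).
Proof. exact/flat_projective/projective_zero_mod. Qed.

Lemma weak_dim_le1_coker (K P : rmodType R) (i : {linear K -> P}) :
  flat_mod K -> flat_mod P -> injective i -> weak_dim_le 1 (quot (range_sm i)).
Proof.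
move=> Kf Pf iI.
exact: (short_resolution flat_zero_mod Kf Pf iI (@quot_exact _ _ _ i) (@quot_projP _ _ _)).
Qed.

Lemma flat_weak_dim_le1 (F : rmodType R) : flat_mod F -> weak_dim_le 1 F.
Proof.
move=> Ff; pose z := zero_map (zero_mod R^c) F.
have zI : injective z by move=> x y _; rewrite (zero_modE x) (zero_modE y).
have ze : exact_at z (idfun : {linear F -> F}).
  by move=> x; split=> [/= ->|[y <-]]; [exists 0 | ].
apply: (short_resolution flat_zero_mod flat_zero_mod Ff zI ze).
by move=> x; exists x.
Qed.

Lemma proj_dim_weak_dim_le1 (M : rmodType R) : proj_dim_le 1 M -> weak_dim_le 1 M.
Proof.
move=> /resolution_dim_le1 [K [P [i [p [Kp Pp iI ip pS]]]]].
exact: (short_resolution flat_zero_mod (flat_projective Kp) (flat_projective Pp) iI ip pS).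
Qed.

Lemma injective_weak_injective (M : rmodType R) : injective_mod M -> weak_injective M.
Proof. by move=> Mi I _; apply: injective_Ext1_zero. Qed.

Lemma homomorphic_image_trans (A : pzRingType) (L M N : lmodType A) :
  homomorphic_image L M -> homomorphic_image M N -> homomorphic_image L N.
Proof.
move=> [f fS] [g gS]; exists (g \o f : {linear _ -> _}) => z.
by have [y <-] := gS z; have [x <-] := fS y; exists x.
Qed.

(** [R / s R] has weak dimension at most one, so maps [R -> M] extend along the
    multiplication by [s]. *)
Lemma weak_injective_divisible (M : rmodType R) : weak_injective M -> divisible M.
Proof.
move=> Mw s [sl _] m; pose i : {linear (R^c)^o -> (R^c)^o} := scale_at (s : (R^c)^o).
have iI : injective i by move=> a b; apply: sl.
have Rf : flat_mod (R^c)^o by exact/flat_projective/projective_regular.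
have [g gE] := Ext1_extend (scale_at m) (Mw _ (weak_dim_le1_coker Rf Rf iI)) iI
  (@quot_exact _ _ _ i) (@quot_projP _ _ _).
exists (g (1 : R)); rewrite -linearZ.
transitivity (g (i (1 : R))); first by congr (g _); exact: etrans (mul1r s) (esym (mulr1 s)).
by rewrite gE; exact: scale1r.
Qed.

(** Let [K] be the kernel of a free cover [P] of [M]; to lift [K -> Y] along [X -> Y],
    embed [X] into an injective [E], so that [Y] is a submodule of [E / N] with [N]
    the kernel of [X -> Y].  Then [K -> Y] extends to [P -> E / N], which lifts to
    [P -> E], whose restriction to [K] takes values in [X]. *)
Lemma proj_dim_le1_of_quotients (M : rmodType R) :
  (forall E N : rmodType R, injective_mod E -> homomorphic_image E N -> Ext1_zero M N) ->
  proj_dim_le 1 M.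
Proof.
move=> EN; pose P := free_mod R^c M; pose p : {linear P -> M} := linear_comb id.
pose K := subm (kernel_sm p); pose i : {linear K -> P} := subm_incl (kernel_sm p).
have Pp : projective_mod P by exact: projective_free.
have iI : injective i by exact: subm_inj.
have ip : exact_at i p by exact: kernel_exact.
have pS : surj p by exact: free_cover.
apply: (short_resolution (@projective_zero_mod _) _ Pp iI ip pS).
move=> X Y e f eS; have [E [eps [Ei epsI]]] := enough_injectives X.
pose N := range_sm (eps \o subm_incl (kernel_sm e) : {linear _ -> _}).
have Nker x : quot_proj N (eps x) = 0 <-> e x = 0.
  split=> [/quot_proj0 [w /= /epsI <-]|e0]; first exact: (submP w).
  apply/quot_proj0; have [w wE] := @subm_exists _ _ (kernel_sm e) x e0.
  by exists w; rewrite /= wE.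
have [x /Nker //|y yE] := factor_surj (f := (quot_proj N \o eps : {linear _ -> _})) eS.
have yI : injective y.
  apply: inj_of_ker => z; have [x <-] := eS z; rewrite yE => /Nker //.
have EN0 : Ext1_zero M (quot N).
  by apply: (EN E) => //; exists (quot_proj N); exact: quot_projP.
have [G GE] := Ext1_extend (y \o f : {linear _ -> _}) EN0 iI ip pS.
have [g gE] := Pp _ _ (quot_proj N) G (@quot_projP _ _ N).
have [k|h hE] := factor_inj epsI (f := (g \o i : {linear _ -> _})).
  have [x ex] := eS (f k).
  have /quot_proj0 [w wE] : quot_proj N (g (i k) - eps x) = 0.
    by rewrite linearB /= gE GE /= -ex yE /= subrr.
  exists (x + subm_incl (kernel_sm e) w).
  by rewrite linearD; have /= -> := wE; rewrite addrC subrK.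
exists h => k; apply: yI; rewrite yE /= hE /= gE GE; exact: erefl.
Qed.

End WeakDimension.

Section Equivalences.
Variables (R Q : pzRingType) (iota : {rmorphism R -> Q}).
Hypothesis Qq : is_classical_quotient_ring iota.
Local Notation res := (restrict iota).
Local Notation Q_R := (restr_right iota : rmodType R).

(** Choosing all of [Hom(Q, M)] as index set makes every map [Q -> M] lift to the
    free module, whence the kernel is Matlis-cotorsion. *)
Lemma h_divisible_presentation (M : rmodType R) : h_divisible iota M ->
  exists (V : rmodType Q) (e : {linear res V -> M}),
    surj e /\ Matlis_cotorsion iota (subm (kernel_sm e)).
Proof.
move=> [I [D [inj [Ds [p pS]]]]].
pose H := {classic {linear Q_R -> M}}.
have [e eE] := restrict_free_out (X := H) (fun h : H => h : {linear Q_R -> M}).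
exists (free_mod Q^c H), e; split.
  pose c := quot_proj (range_sm e).
  have [g [_ gu]] := Ds _ (fun i => zero_map Q_R (quot (range_sm e))).
  move=> m; have [d <-] := pS m.
  have : (c \o p : {linear _ -> _}) d = zero_map D (quot (range_sm e)) d.
    rewrite (gu (c \o p : {linear _ -> _})) => [|i q]; last first.
      apply/quot_proj0.
      by exists ((q : Q^c) *: basis Q^c ((p \o inj i : {linear _ -> _}) : H)); rewrite eE.
    by rewrite (gu (zero_map _ _)).
  by move=> /quot_proj0.
apply: Ext1_zero_of_retraction => E; set N := subm (kernel_sm e) in E *.
pose n : {linear N -> res (free_mod Q^c H)} := subm_incl (kernel_sm e).
have [w wE] := Ext1_extend n (Matlis_cotorsion_restrict Qq (C := free_mod Q^c H))
  (@ext_injP _ _ _ E) (@ext_exactP _ _ _ E) (@ext_projP _ _ _ E).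
have [x /(@ext_exactP _ _ _ E)[b <-]|h hE] :=
  factor_surj (f := (e \o w : {linear _ -> _})) (@ext_projP _ _ _ E).
  by rewrite /= wE; exact: (submP b).
pose d : {linear ext_mid E -> res (free_mod Q^c H)} :=
  (w \- (orbit_map (basis Q^c (h : H)) \o ext_proj E) : {linear _ -> _}).
have [x|r rE] := factor_inj (@subm_inj _ _ (kernel_sm e)) (f := d).
  apply: (@subm_exists _ _ (kernel_sm e)); rewrite /= linearB /= /orbit_map eE.
  by rewrite hE /= subrr.
exists r => b; apply: (@subm_inj _ _ (kernel_sm e)); rewrite rE /= wE.
have -> : ext_proj E (ext_inj E b) = 0 by apply/(@ext_exactP _ _ _ E); exists b.
by rewrite /orbit_map [X in _ - X]scale0r subr0.
Qed.

Lemma h_divisible_divisible (M : rmodType R) : h_divisible iota M -> divisible M.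
Proof.
move=> /h_divisible_presentation [V [e [eS _]]] s sreg m.
have [v <-] := eS m; have [t st] := regular_denom Qq sreg.
by exists (e ((t : Q^c) *: (v : V))); rewrite -linearZ restrict_scaleE (scale_denomK _ st).2.
Qed.

(** [Q / R] has weak dimension at most one, so maps [R -> M] extend to [Q]. *)
Lemma weak_injective_h_divisible (M : rmodType R) :
  weak_injective M -> h_divisible iota M.
Proof.
move=> Mw; pose i : {linear (R^c)^o -> Q_R} := iota_map iota.
have iI : injective i by exact: (cq_inj Qq).
have Rf : flat_mod (R^c)^o by exact/flat_projective/projective_regular.
have QRw := weak_dim_le1_coker Rf (flat_quotient_ring Qq) iI.
have /choice[h hE] m : exists h : {linear Q_R -> M}, h (1 : Q) = m.
  have [h hE] := Ext1_extend (scale_at m) (Mw _ QRw) iI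
    (@quot_exact _ _ _ i) (@quot_projP _ _ _).
  exists h; have := hE (1 : R); rewrite /= /scale_at /iota_map scale1r => <-.
  by rewrite rmorph1.
exists M, (dsum M Q_R), (@dsum_in R^c M Q_R); split; first exact: dsum_is_direct_sum.
by exists (dsum_out h) => m; exists (dsum_in Q_R m (1 : Q)); rewrite /= dsum_out_in hE.
Qed.

Section FlatStronglyFlat.
Hypothesis flat_sf : forall C : rmodType R, Matlis_cotorsion iota C -> Enochs_cotorsion C.

(** For a surjection [M -> N] of [Q]-modules, the kernel is Matlis-cotorsion, and
    [loc F] is flat over [R]. *)
Lemma projective_loc_flat (F : rmodType R) : flat_mod F -> projective_mod (loc Qq F).
Proof.
move=> Ff M N p f pS; pose c := subm_incl (kernel_sm p).
pose cR : {linear res (subm (kernel_sm p)) -> res M} := restrict_map iota c.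
pose pR : {linear res M -> res N} := restrict_map iota p.
have cI : injective cR by exact: (@subm_inj _ _ (kernel_sm p)).
have cp : exact_at cR pR by exact: (@kernel_exact _ _ _ p).
have ext0 : Ext1_zero (res (loc Qq F)) (res (subm (kernel_sm p))).
  apply: flat_sf; [exact: (Matlis_cotorsion_restrict Qq) | exact: flat_loc].
pose fR : {linear res (loc Qq F) -> res N} := restrict_map iota f.
have [g gE] := Ext1_lift fR ext0 cI cp pS.
have [h hE] := linear_over_quotient Qq g.
by exists h => x; rewrite hE; exact: gE.
Qed.

Hypothesis Fd : right_Fdim_zero Q.

(** [f] lifts to [V] in a presentation [V -> M], hence extends to the localisation
    of [K], which is a direct summand of that of [F]. *)
Lemma h_divisible_extend (M K F : rmodType R) (j : {linear K -> F}) (f : {linear K -> M}) :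
  h_divisible iota M -> flat_mod K -> flat_mod F -> injective j ->
  exists g : {linear F -> M}, forall x, g (j x) = f x.
Proof.
move=> /h_divisible_presentation [V [e [eS Nm]]] Kf Ff jI.
have [g gE] := Ext1_lift f (flat_sf Nm Kf) (@subm_inj _ _ (kernel_sm e))
  (@kernel_exact _ _ _ e) eS.
have [G GE] := loc_extend Qq g.
have [J [JE /(_ jI) JI]] := loc_functor Qq j.
have [r rE] := split_of_Fdim_zero Fd (projective_loc_flat Kf) (projective_loc_flat Ff) JI.
exists (e \o (restrict_map iota G \o (restrict_map iota r \o loc_map Qq F)) : {linear _ -> _}).
move=> x; rewrite -[RHS]gE /=; congr (e _); rewrite -[RHS]GE.
by congr (G _); rewrite -[RHS]rE JE.
Qed.

Lemma h_divisible_weak_injective (M : rmodType R) :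
  h_divisible iota M -> weak_injective M.
Proof.
move=> Mh I /resolution_dim_le1 [F1 [F0 [i [p [F1f F0f iI ip pS]]]]].
apply: (Ext1_zero_of_extend _ ip pS) => [|f]; last exact: h_divisible_extend.
pose q : {linear free_mod R^c F0 -> F0} := linear_comb id.
have Pp : projective_mod (free_mod R^c F0) by exact: projective_free.
have Pf := flat_projective Pp.
have qe := @kernel_exact _ _ _ q.
have qS : surj q by exact: free_cover.
apply: (Ext1_zero_of_extend (@projective_Ext1_zero _ _ M Pp) qe qS) => f.
apply: h_divisible_extend => //; last exact: subm_inj.
exact: (flat_kernel Pf F0f (@subm_inj _ _ _) qe qS).
Qed.

End FlatStronglyFlat.

Section FlatProjDim.
Hypothesis Fd : right_Fdim_zero Q.
Hypothesis wd_pd : forall M : rmodType R, weak_dim_le 1 M -> proj_dim_le 1 M.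

(** A presentation [0 -> K -> P -> V -> 0] over [R] with [K], [P] projective splits
    after localisation, which leaves [V] unchanged. *)
Lemma projective_of_flat_restrict (V : rmodType Q) : flat_mod (res V) -> projective_mod V.
Proof.
move=> Vf; pose P := free_mod R^c (res V); pose p : {linear P -> res V} := linear_comb id.
pose K := subm (kernel_sm p); pose j : {linear K -> P} := subm_incl (kernel_sm p).
have Pp : projective_mod P by exact: projective_free.
have jI : injective j by exact: subm_inj.
have jp : exact_at j p by exact: kernel_exact.
have pS : surj p by exact: free_cover.
have Kp := projective_kernel (wd_pd (flat_weak_dim_le1 Vf)) Pp jI jp pS.
have [J [JE /(_ jI) JI]] := loc_functor Qq j.
have [r rE] := split_of_Fdim_zero Fd (projective_loc Kp) (projective_loc Pp) JI.
have [pQ pQE] := loc_extend Qq p.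
have pQS : surj pQ by move=> v; have [x <-] := pS v; exists (loc_map Qq P x).
have pJ v : pQ (J v) = 0.
  transitivity (zero_map (loc Qq K) V v); last by [].
  apply: (@loc_ext _ _ _ Qq _ _ (pQ \o J : {linear _ -> _})) => k /=.
  by rewrite JE pQE; apply/jp; exists k.
have [v|s sE] := factor_surj (f := (idfun \- (J \o r) : {linear _ -> _})) pQS.
  have [x [d [t [dt ->]]]] := loc_map_surj v.
  rewrite linearZ pQE => /(congr1 (fun u : V => (iota d : Q^c) *: u)).
  rewrite scaler0 (scale_denomK _ dt).2 => /jp [k <-].
  by rewrite -JE -linearZ /= rE subrr.
apply: (@projective_retract _ _ (loc Qq P)); last exact: projective_loc.
exists s, pQ => w; have [v <-] := pQS w.
by rewrite sE linearB /= pJ subr0.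
Qed.

(** [0 -> M -> V -> V/M -> 0] with [V] the localisation: [Ext^1(V, C)] vanishes since
    [V] is projective over [Q], and [Ext^2(V/M, C)] since [V/M] has weak dimension
    at most one; the latter is read off from the projectivity of the preimage of
    [M] in a free cover of [V]. *)
Lemma flat_strongly_flat (M : rmodType R) : flat_mod M -> strongly_flat iota M.
Proof.
move=> Mf C Cm; pose V := loc Qq M; pose lam : {linear M -> res V} := loc_map Qq M.
have lI : injective lam by exact: flat_loc_map_inj.
have Vf : flat_mod (res V) by exact: flat_loc.
have V0 : Ext1_zero (res V) C.
  exact: (projective_restrict_strongly_flat (projective_of_flat_restrict Vf) Cm).
pose q := quot_proj (range_sm lam).
have qd := wd_pd (weak_dim_le1_coker Mf Vf lI).
pose P := free_mod R^c (res V); pose p : {linear P -> res V} := linear_comb id.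
have Pp : projective_mod P by exact: projective_free.
have pS : surj p by exact: free_cover.
pose qp : {linear P -> quot (range_sm lam)} := (q \o p : {linear _ -> _}).
pose i := subm_incl (kernel_sm qp).
have qpS : surj qp.
  by move=> x; have [v <-] := @quot_projP _ _ (range_sm lam) x; have [y <-] := pS v; exists y.
have Wp : projective_mod (subm (kernel_sm qp)).
  exact: (projective_kernel qd Pp (@subm_inj _ _ _) (@kernel_exact _ _ _ qp) qpS).
have [x|p0 p0E] := factor_inj lI (f := (p \o i : {linear _ -> _})).
  by have /quot_proj0 := submP x.
have p0S : surj p0.
  move=> m; have [y py] := pS (lam m).
  have [|w wE] := @subm_exists _ _ (kernel_sm qp) y.
    by rewrite /= py; apply/quot_proj0; exists m.
  by exists w; apply: lI; rewrite p0E /= /i wE.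
have ker x : p (i x) = 0 <-> p0 x = 0.
  split=> [e|e]; last by have /= <- := p0E x; rewrite e linear0.
  by apply: lI; rewrite p0E linear0.
apply: (Ext1_zero_of_extend (@projective_Ext1_zero _ _ C Wp)
  (@kernel_exact _ _ _ p0) p0S) => f.
pose j := subm_incl (kernel_sm p).
have [k|k0 k0E] := factor_inj (@subm_inj _ _ (kernel_sm qp)) (f := j).
  apply: (@subm_exists _ _ (kernel_sm qp)).
  by rewrite /= (submP k : p (j k) = 0) linear0.
have [k|k1 k1E] := factor_inj (@subm_inj _ _ (kernel_sm p0)) (f := k0).
  apply: (@subm_exists _ _ (kernel_sm p0)); apply/ker; rewrite /i k0E.
  exact: (submP k).
have [g gE] := Ext1_extend (f \o k1 : {linear _ -> _}) V0 (@subm_inj _ _ (kernel_sm p))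
  (@kernel_exact _ _ _ p) pS.
exists (g \o i : {linear _ -> _}) => x /=.
have [|k kE] := @subm_exists _ _ (kernel_sm p) (i (subm_incl (kernel_sm p0) x)).
  by apply/ker; exact: (submP x).
rewrite -kE gE /=; congr (f _); apply: (@subm_inj _ _ (kernel_sm p0)).
by rewrite k1E; apply: (@subm_inj _ _ (kernel_sm qp)); rewrite k0E kE.
Qed.

End FlatProjDim.

End Equivalences.

Theorem theorem5p2 (R Q : pzRingType) (iota : {rmorphism R -> Q})
    (R_Ore : right_left_Ore R)
    (Q_quot : is_classical_quotient_ring iota)
    (Q_Fdim : right_Fdim_zero Q) :
  [<-> (* (i) *)
       forall M : rmodType R, flat_mod M -> strongly_flat iota M;
       (* (ii) *)
       forall M : rmodType R, Matlis_cotorsion iota M -> Enochs_cotorsion M;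
       (* (iii) *)
       forall M : rmodType R, h_divisible iota M -> weak_injective M;
       (* (iv) *)
       forall M N : rmodType R,
         weak_injective M -> homomorphic_image M N -> weak_injective N;
       (* (v) *)
       forall M N : rmodType R,
         injective_mod M -> homomorphic_image M N -> weak_injective N;
       (* (vi) *)
       forall M : rmodType R, weak_dim_le 1 M -> proj_dim_le 1 M;
       (* (vii) *)
       (forall M : rmodType R, proj_dim_le 1 M <-> weak_dim_le 1 M) /\
       (forall M : rmodType R, divisible M <-> weak_injective M);
       (* (viii) *)
       forall M : rmodType R, divisible M -> weak_injective M].
Proof.
have iii_iv : (forall M : rmodType R, h_divisible iota M -> weak_injective M) ->
    forall M N : rmodType R, weak_injective M -> homomorphic_image M N -> weak_injective N.
  move=> h3 M N /(weak_injective_h_divisible Q_quot) [I [D [inj [Ds DM]]]] MN.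
  by apply: h3; exists I, D, inj; split=> //; apply: homomorphic_image_trans MN.
have v_vi : (forall M N : rmodType R,
      injective_mod M -> homomorphic_image M N -> weak_injective N) ->
    forall M : rmodType R, weak_dim_le 1 M -> proj_dim_le 1 M.
  by move=> h5 M Mw; apply: proj_dim_le1_of_quotients => E N Ei EN; apply: (h5 E).
tfae.
- by move=> h1 M Mm F Ff; apply: h1.
- by move=> h2 M; apply: h_divisible_weak_injective.
- exact: iii_iv.
- by move=> h4 M N Mi; apply/h4/injective_weak_injective.
- exact: v_vi.
- move=> h6; split=> M; split; [exact: proj_dim_weak_dim_le1 | exact: h6 | |].
    by move=> Md I Iw; apply: (divisible_Ext1_zero Q_quot Md Q_Fdim); apply: h6.
  exact: weak_injective_divisible.
- by move=> [_ h7] M /h7.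
move=> h8 M; apply: (flat_strongly_flat Q_quot Q_Fdim); apply: v_vi => E N Ei.
apply: iii_iv; last exact: injective_weak_injective.
by move=> L /(h_divisible_divisible Q_quot); apply: h8.
Qed.
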